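(* Let $C\subset\mathbb{R}^{n+1}$ ($n\ge 1$) be a cylindrically bounded convex body. Then the isoperimetric profile $I_C$ is a continuous function on $[0,\infty)$.
   Context: A closed unbounded convex set $C\subset\mathbb{R}^{n+1}$ with non-empty interior is a cylindrically bounded convex body if its orthogonal projection onto some hyperplane is bounded and $C$ is not itself a cylinder (i.e. it contains no complete line). For measurable $E\subset C$, $|E|$ denotes the $(n+1)$-dimensional Hausdorff (Lebesgue) measure. The relative perimeter of $E$ in the interior of $C$ is $P_C(E)=\sup\{\int_E \operatorname{div}\xi\, dH^{n+1} : \xi \text{ smooth vector field with compact support in } \operatorname{int}(C),\ |\xi|\le 1\}$. The isoperimetric profile is $I_C(v)=\inf\{P_C(E): E\subset C,\ |E|=v\}$, with $I_C(0)=0$. *)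

(* Defs.v *)
From HB Require Import structures.
From mathcomp Require Import all_boot all_order all_algebra.
From mathcomp Require Import all_classical all_reals all_analysis.

Set Implicit Arguments.
Unset Strict Implicit.
Unset Printing Implicit Defensive.

Import Order.TTheory GRing.Theory Num.Theory.
Import numFieldNormedType.Exports.

Local Open Scope classical_set_scope.
Local Open Scope ring_scope.

(* The sigma-algebra on 'rV[R]_n generated by the coordinates, that is, the
   Borel sigma-algebra of R^n. *)
Definition rV_display : measure_display.
Proof. exact: default_measure_display. Qed.

Section measurable_rV.
Context {R : realType}.
Variable n : nat.

Definition rV_coord (i : 'I_n) (x : 'rV[R]_n) : measurableTypeR R := x 0 i.

Let rV_set0 : g_sigma_preimage rV_coord set0.
Proof. exact: sigma_algebra0. Qed.

Let rV_setC A : g_sigma_preimage rV_coord A -> g_sigma_preimage rV_coord (~` A).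
Proof. exact: sigma_algebraC. Qed.

Let rV_bigcup (F : (set 'rV[R]_n)^nat) :
  (forall i, g_sigma_preimage rV_coord (F i)) ->
  g_sigma_preimage rV_coord (\bigcup_i (F i)).
Proof. exact: sigma_algebra_bigcup. Qed.

HB.instance Definition _ := @isMeasurable.Build rV_display
  'rV[R]_n (g_sigma_preimage rV_coord) rV_set0 rV_setC rV_bigcup.

End measurable_rV.

Lemma measurable_rV_coord (R : realType) n (i : 'I_n) :
  measurable_fun [set: 'rV[R]_n] (rV_coord i).
Proof.
move=> _ Y mY; rewrite setTI; apply: sub_sigma_algebra => /=.
rewrite -bigcup_seq/=; exists i => /=; first by rewrite mem_index_enum.
by exists Y => //; rewrite setTI.
Qed.

Lemma measurable_fun_rVP (R : realType) d (T : measurableType d) n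
    (f : T -> 'rV[R]_n) :
  (forall i, measurable_fun [set: T] (rV_coord i \o f)) ->
  measurable_fun [set: T] f.
Proof.
move=> mf.
suff H : g_sigma_preimage (fun i => rV_coord i \o f) `<=` measurable.
  by move=> _ A mA; apply: H; rewrite g_sigma_preimage_comp; exists A.
apply: smallest_sub; first exact: sigma_algebra_measurable.
case: n => [|n] in f mf *; first by rewrite big_ord0.
rewrite -bigcup_mkord_ord; apply: bigcup_sub => i Ii.
by move=> A [B mB <-]; exact: mf.
Qed.

Section lebesgue_rV.
Context {R : realType}.

Definition rV_cons n (p : measurableTypeR R * 'rV[R]_n) : 'rV[R]_n.+1 :=
  row_mx (p.1 : R)%:M p.2 : 'rV[R]_(1 + n).

Definition rV_uncons n (x : 'rV[R]_n.+1) : measurableTypeR R * 'rV[R]_n :=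
  (x 0 0, rsubmx (x : 'rV[R]_(1 + n))).

Lemma rV_consK n : cancel (@rV_cons n) (@rV_uncons n).
Proof.
move=> [a x]; rewrite /rV_uncons /rV_cons /= row_mxKr; congr pair.
rewrite [LHS](_ : _ = row_mx (a : R)%:M x 0 (lshift n (0 : 'I_1))).
  by rewrite row_mxEl mxE eqxx.
congr (fun_of_matrix _ _ _); exact/val_inj.
Qed.

Lemma measurable_rV_cons n : measurable_fun setT (@rV_cons n).
Proof.
apply: measurable_fun_rVP => i.
case: (splitP (i : 'I_(1 + n))) => j ij.
  have -> : i = lshift n (0 : 'I_1) by apply/val_inj; rewrite /= ij (ord1 j).
  rewrite [X in measurable_fun _ X](_ : _ = fst); first exact: measurable_fst.
  by apply/funext => p; apply: (etrans (row_mxEl _ _ _ _)); rewrite mxE eqxx.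
have -> : i = rshift 1 j by exact/val_inj.
rewrite [X in measurable_fun _ X](_ : _ = rV_coord j \o snd).
  exact: (measurableT_comp (@measurable_rV_coord R n j) measurable_snd).
by apply/funext => p; exact: (etrans (row_mxEr _ _ _ _)).
Qed.

Lemma measurable_rV_uncons n : measurable_fun setT (@rV_uncons n).
Proof.
apply/measurable_fun_pairP; split.
  exact: (@measurable_rV_coord R n.+1 0).
apply: measurable_fun_rVP => i.
rewrite [X in measurable_fun _ X](_ : _ = rV_coord (rshift 1 i : 'I_n.+1)).
  exact: measurable_rV_coord.
by apply/funext => x; rewrite /rV_coord /= mxE.
Qed.

Section step.
Local Open Scope ereal_scope.
Variables (n : nat) (m : {sigma_finite_measure set 'rV[R]_n -> \bar R}).

Definition lebesgue_rV_step : set 'rV[R]_n.+1 -> \bar R :=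
  pushforward (@lebesgue_measure R \x m) (@rV_cons n).

Let mf : measurable_fun setT (@rV_cons n) := @measurable_rV_cons n.

Let step0 : lebesgue_rV_step set0 = 0.
Proof. by rewrite /lebesgue_rV_step /pushforward preimage_set0 measure0. Qed.

Let step_ge0 A : 0 <= lebesgue_rV_step A.
Proof. exact: measure_ge0. Qed.

Let step_sigma_additive : semi_sigma_additive lebesgue_rV_step.
Proof.
exact: (@measure_semi_sigma_additive _ _ _
  (measure_function_pushforward__canonical__measure_function_Measure
    (@lebesgue_measure R \x m) mf)).
Qed.

HB.instance Definition _ := isMeasure.Build _ _ _ lebesgue_rV_step
  step0 step_ge0 step_sigma_additive.

Let step_sigma_finite : sigma_finite setT lebesgue_rV_step.
Proof.
have /sigma_finiteP[F [TF ndF Foo]] := sigma_finiteT (@lebesgue_measure R).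
have /sigma_finiteP[G [TG ndG Goo]] := sigma_finiteT m.
exists (fun k => @rV_uncons n @^-1` (F k `*` G k)).
  apply/esym; rewrite -subTset => x _.
  have [k _ Fk] : (\bigcup_k F k) (rV_uncons x).1 by rewrite -TF.
  have [l _ Gl] : (\bigcup_k G k) (rV_uncons x).2 by rewrite -TG.
  exists (maxn k l) => //; split.
    by move: Fk; exact/subsetPset/ndF/leq_maxl.
  by move: Gl; exact/subsetPset/ndG/leq_maxr.
move=> k; have [mFk Fk] := Foo k; have [mGk Gk] := Goo k; split.
  rewrite -[X in measurable X]setTI; apply: measurable_rV_uncons => //.
  exact: measurableX.
rewrite /lebesgue_rV_step /pushforward -comp_preimage.
rewrite (_ : _ \o _ = id); last by apply/funext => x; exact: rV_consK.
rewrite preimage_id product_measure1E//.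
by rewrite lte_mul_pinfty// ge0_fin_numE.
Qed.

HB.instance Definition _ := Measure_isSigmaFinite.Build _ _ _
  lebesgue_rV_step step_sigma_finite.

End step.

Definition lebesgue_rV0 : set 'rV[R]_0 -> \bar R := dirac (0 : 'rV[R]_0).
HB.instance Definition _ := Measure.on lebesgue_rV0.
HB.instance Definition _ := SigmaFiniteMeasure.on lebesgue_rV0.

(* Lebesgue measure on the Borel sets of R^n, as an iterated product. *)
Fixpoint borel_lebesgue n : {sigma_finite_measure set 'rV[R]_n -> \bar R} :=
  match n with
  | 0 => lebesgue_rV0
  | k.+1 => lebesgue_rV_step (borel_lebesgue k)
  end.

(* Lebesgue measurable sets are the Caratheodory measurable sets of the outer
   measure induced by borel_lebesgue. *)
Definition lebesgue_measurable n (E : set 'rV[R]_n) : Prop :=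
  ((borel_lebesgue n)^*)%mu.-cara.-measurable E.

Definition lebesgue_rV n :
    set (caratheodory_type ((borel_lebesgue n)^*)%mu) -> \bar R :=
  @completed_measure_extension _ _ _ (borel_lebesgue n).

HB.instance Definition _ n := Measure.on (@lebesgue_rV n).

End lebesgue_rV.
Arguments lebesgue_rV : clear implicits.

Section euclidean.
Context {R : realType}.
Variable n : nat.
Implicit Types (x y u : 'rV[R]_n) (f : 'rV[R]_n -> R) (xi : 'rV[R]_n -> 'rV[R]_n).

Definition dot x y : R := \sum_i x 0 i * y 0 i.

(* The library norm on 'rV[R]_n is the sup norm. *)
Definition enorm x : R := Num.sqrt (dot x x).

(* Orthogonal projection onto the hyperplane of equation dot x u = c, where u
   is a unit vector. *)
Definition hyperplane_proj u (c : R) x : 'rV[R]_n := x + (c - dot x u) *: u.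

Definition contains_line (C : set 'rV[R]_n) : Prop :=
  exists p v, v != 0 /\ forall t : R, C (p + t *: v).

Record cylindrically_bounded_body (C : set 'rV[R]_n) : Prop := {
  cbb_closed : closed C;
  cbb_unbounded : ~ bounded_set C;
  cbb_convex : convex_set C;
  cbb_interior : C° !=set0;
  cbb_bounded_proj :
    exists u c, enorm u = 1 /\ bounded_set (hyperplane_proj u c @` C);
  cbb_no_line : ~ contains_line C }.

Definition partial (i : 'I_n) f : 'rV[R]_n -> R := fun x => 'D_(delta_mx 0 i) f x.

(* f is C^oo: all iterated partial derivatives exist and are continuous. *)
Definition smooth f : Prop :=
  forall s : seq 'I_n, let g := foldr partial f s in
    continuous g /\ forall i x, derivable g x (delta_mx 0 i).

Definition component xi (i : 'I_n) : 'rV[R]_n -> R := fun x => xi x 0 i.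

Definition support xi : set 'rV[R]_n := closure [set x | xi x != 0].

Definition divergence xi : 'rV[R]_n -> R :=
  fun x => \sum_i partial i (component xi i) x.

Definition test_fields (C : set 'rV[R]_n) : set ('rV[R]_n -> 'rV[R]_n) :=
  [set xi | [/\ forall i, smooth (component xi i),
                compact (support xi), support xi `<=` C° &
                forall x, enorm (xi x) <= 1]].

Local Open Scope ereal_scope.

Definition perimeter (C E : set 'rV[R]_n) : \bar R :=
  ereal_sup [set \int[lebesgue_rV R n]_(x in E) (divergence xi x)%:E
            | xi in test_fields C].

(* The infimum is taken in \bar R, where it is +oo over the empty family. *)
Definition isoperimetric_profile (C : set 'rV[R]_n) (v : R) : \bar R :=
  if v == 0%R then 0
  else ereal_inf [set perimeter C E | E in
    [set E | [/\ lebesgue_measurable E, E `<=` C & lebesgue_rV R n E = v%:E]]].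

End euclidean.

(* Main.v *)
(** A cylindrically bounded body C is stable under x |-> x + t d (t >= 0) for some
    d <> 0, and the bodies C + t d have empty intersection.  If E is a subset of
    C, then (E - t d) /\ C has perimeter at most that of E, because a test field
    of C translated by t d is again a test field of C; its volume is that of
    E /\ (C + t d), which decreases continuously to 0 as t grows.  Hence the
    profile is nondecreasing.

    In the other direction, since E has finite volume, a small cube of C can be
    translated along d until it is almost disjoint from E.  Adding it to E
    increases the volume by at least half the volume of the cube, and the
    perimeter by at most a constant times r ^ n, where r is the side and n.+1 the
    dimension.  So for every eps > 0 there is delta > 0 such that
    I_C (v + delta) <= I_C v + eps for all v >= 0.  With monotonicity this gives
    finiteness and uniform continuity. *)

Require Import Defs.
From HB Require Import structures.
From mathcomp Require Import all_boot all_order all_algebra.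
From mathcomp Require Import all_classical all_reals all_analysis.
From mathcomp Require Import ring lra.
From mathcomp Require Import measurable_realfun.

Set Implicit Arguments.
Unset Strict Implicit.
Unset Printing Implicit Defensive.

Import Order.TTheory GRing.Theory Num.Theory.
Import numFieldNormedType.Exports.
Local Open Scope classical_set_scope.
Local Open Scope ring_scope.

(** Three obstacles shape the proof. Perimeter is available only as a supremum over test fields, so
    the cost of adding a cube is obtained by cutting fields off: [phi k] tends to the indicator of
    the cube while the L^1 norm of its gradient stays of order r ^ n. As the field supplies the
    compact support, [phi k] may be a product of rational functions 1 / (1 + w ^ 2), one for each
    coordinate; these are smooth by closure under products and inverses, and their integrals are
    compared with arctangents, which is the origin of the factors pi. Truncation at t has a volume
    continuous in t only if the part of the body lost at a single instant is null; that part meets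
    each line parallel to d at most once, so its translates along d are disjoint. Finally, the
    volume gained by adding a cube varies with E; monotonicity replaces it by half the volume of the
    cube, so that the modulus of continuity does not depend on v. *)

Local Notation cara R n := (caratheodory_type ((@borel_lebesgue R n)^*)%mu).

(** * Borel sets of row vectors *)

Lemma ler_coord_norm (R : realType) n (x : 'rV[R]_n) i : `|x 0 i| <= `|x|.
Proof.
rewrite [leRHS]/Num.Def.normr /= mx_normrE.
by apply/bigmax_geP; right => /=; exists (0, i).
Qed.

Lemma norm_rV_lt (R : realType) n (x : 'rV[R]_n) (e : R) : 0 < e ->
  (forall i, `|x 0 i| < e) -> `|x| < e.
Proof.
move=> e0 xe; rewrite [ltLHS]/Num.Def.normr /= mx_normrE.
by apply/bigmax_ltP; split=> // -[i j] _ /=; rewrite (ord1 i).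
Qed.

Lemma measurable_coord_preimage (R : realType) n (i : 'I_n) (B : set R) :
  measurable B -> measurable [set x : 'rV[R]_n | B (x 0 i)].
Proof.
move=> mB; rewrite -[X in measurable X]setTI.
exact: (@measurable_rV_coord R n i).
Qed.

Lemma measurable_box (R : realType) n (B : 'I_n -> set R) :
  (forall i, measurable (B i)) -> measurable [set x : 'rV[R]_n | forall i, B i (x 0 i)].
Proof.
move=> mB.
rewrite [X in measurable X](_ : _ =
    \bigcap_(i in [set: 'I_n]) [set x : 'rV[R]_n | B i (x 0 i)]); last first.
  by apply/seteqP; split => x /=; [move=> Bx i _; exact: Bx|move=> Bx i; exact: Bx].
apply: fin_bigcap_measurable => [|i _]; first exact: finite_finset.
exact: measurable_coord_preimage.
Qed.

(** The sigma-algebra is generated by the coordinates, so an open set has to be written as a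
    countable union of boxes with rational centre and radius. *)
Lemma open_rV_measurable (R : realType) n (A : set 'rV[R]_n) :
  open A -> measurable A.
Proof.
move=> oA.
pose I (q : 'rV[rat]_n * rat) i : set R :=
  `]ratr (q.1 0 i) - ratr q.2, ratr (q.1 0 i) + ratr q.2[%classic.
pose box q : set 'rV[R]_n := [set x | forall i, I q i (x 0 i)].
have mbox q : measurable (box q) by exact: (measurable_box (fun i => measurable_itv _)).
rewrite [X in measurable X](_ : _ = \bigcup_(q in [set q | box q `<=` A]) box q).
  rewrite bigcup_mkcond; apply: countable_bigcupT_measurable => // q.
  by case: ifPn.
apply/seteqP; split => x; last by move=> [q qA]; exact: qA.
move=> Ax; have /nbhs_ballP[e /= e0 eA] := open_nbhs_nbhs (conj oA Ax).
(* Half of [e], because two points of a box of radius r can be at distance almost 2 r. *)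
have [r /[!in_itv]/= /andP[r0 re]] : exists r, ratr r \in `]0, (e / 2)[%R.
  by apply: rat_in_itvoo; rewrite divr_gt0.
have qP i : exists q, ratr q \in `](x 0 i - ratr r), (x 0 i + ratr r)[%R.
  by apply: rat_in_itvoo; rewrite ltrBlDr -addrA ltrDl addr_gt0.
pose q : 'rV[rat]_n := \row_i xchoose (qP i).
have qE i : x 0 i - ratr r < ratr (q 0 i) < x 0 i + ratr r.
  by rewrite mxE; have := xchooseP (qP i); rewrite in_itv.
exists (q, r) => /=; last first.
  move=> i; have /andP[h1 h2] := qE i.
  by rewrite /I /= in_itv /= ltrBlDr h2 -ltrBlDr h1.
move=> y yq; apply: eA; rewrite -ball_normE /=; apply: norm_rV_lt => // i.
have := yq i; have /andP[h1 h2] := qE i.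
rewrite /I /= in_itv /= => /andP[h3 h4]; rewrite !mxE ltr_norml.
by apply/andP; split; lra.
Qed.

(** * Translation invariance of Lebesgue measure *)

Lemma lebesgue_measure_shift (R : realType) (a : R) (A : set R) : measurable A ->
  lebesgue_measure ((fun x => x + a) @^-1` A) = lebesgue_measure A.
Proof.
move=> mA.
have ms : measurable_fun [set: measurableTypeR R]
    (fun x : R => x + a : measurableTypeR R).
  exact: measurable_funD.
rewrite -[LHS]/(pushforward lebesgue_measure (fun x : R => x + a) A).
apply/esym.
apply: (@lebesgue_measure_unique R
  (measure_function_pushforward__canonical__measure_function_Measure
     lebesgue_measure ms)) => //=.
move=> _ [[x y] _ <-] /=; rewrite /pushforward.
rewrite (_ : _ @^-1` _ = `]x - a, y - a]%classic); last first.
  by apply/seteqP; split => z /=; rewrite !in_itv/= ltrBlDr lerBrDr.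
rewrite !lebesgue_measure_itv /= !lte_fin ltrD2r.
by case: ifP => // _; rewrite -!EFinB; congr EFin; ring.
Qed.

Lemma measurable_shift_rV (R : realType) n (a : 'rV[R]_n) :
  measurable_fun setT (fun x : 'rV[R]_n => x + a).
Proof.
apply: measurable_fun_rVP => i.
rewrite (_ : _ \o _ = (fun t : R => t + a 0 i) \o (rV_coord i)); last first.
  by apply/funext => x; rewrite /rV_coord /= mxE.
apply: measurableT_comp; last exact: measurable_rV_coord.
exact: measurable_funD.
Qed.

Lemma rV_cons_shift (R : realType) n (a : 'rV[R]_n.+1) (p : R * 'rV[R]_n) :
  rV_cons (p.1 + (rV_uncons a).1 : R, p.2 + (rV_uncons a).2) = rV_cons p + a.
Proof.
apply/rowP => i; rewrite /rV_cons /= [RHS]mxE.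
case: (splitP (i : 'I_(1 + n))) => j ij.
  have -> : i = lshift n (0 : 'I_1) by apply/val_inj; rewrite /= ij (ord1 j).
  rewrite [LHS]row_mxEl [X in _ = X + _]row_mxEl !mxE /= !mulr1n.
  by congr (_ + a _ _); exact/val_inj.
have -> : i = rshift 1 j by exact/val_inj.
by rewrite [LHS]row_mxEr [X in _ = X + _]row_mxEr !mxE.
Qed.

(** Induction on the dimension: a product measure is determined by its values on rectangles, and
    there the shift acts on each factor separately. *)
Lemma borel_lebesgue_shift (R : realType) n (a : 'rV[R]_n) (A : set 'rV[R]_n) :
  measurable A ->
  borel_lebesgue n ((fun x => x + a) @^-1` A) = borel_lebesgue n A.
Proof.
elim: n a A => [|n IHn] a A mA.
  congr (_ _); apply/seteqP; split => x /=; rewrite /preimage /= => h.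
    by rewrite (_ : x = x + a) //; apply/rowP; case.
  by rewrite (_ : x + a = x) //; apply/rowP; case.
rewrite /= /lebesgue_rV_step /pushforward.
set b := rV_uncons a.
pose T (p : measurableTypeR R * 'rV[R]_n) : measurableTypeR R * 'rV[R]_n := 
  (p.1 + b.1 : R, p.2 + b.2).
have mT : measurable_fun setT T.
  apply/measurable_fun_pairP; split.
    apply: (@measurableT_comp _ _ _ _ _ _
      (fun t : R => t + b.1 : measurableTypeR R)) => //.
    exact: measurable_funD.
  apply: (@measurableT_comp _ _ _ _ _ _ (fun t : 'rV[R]_n => t + b.2)) => //.
  exact: measurable_shift_rV.
rewrite -[X in (_ \x _)%E X = _](_ : T @^-1` (@rV_cons R n @^-1` A) = _); last first.
  by apply/seteqP; split => p; rewrite /preimage /= /T rV_cons_shift.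
rewrite -[LHS]/(pushforward (lebesgue_measure \x borel_lebesgue n)%E T
  (@rV_cons R n @^-1` A)).
apply/esym.
apply: (@product_measure_unique _ _ _ _ _ lebesgue_measure (borel_lebesgue n)
  (measure_function_pushforward__canonical__measure_function_Measure
     (lebesgue_measure \x borel_lebesgue n)%E mT)); last first.
  rewrite -[X in measurable X]setTI; exact: measurable_rV_cons.
move=> B D mB mD /=; rewrite /pushforward.
rewrite (_ : T @^-1` _ =
  ((fun t : R => t + b.1) @^-1` B) `*` ((fun t => t + b.2) @^-1` D)) //.
rewrite product_measure1E//.
- by congr (_ * _)%E; [exact: lebesgue_measure_shift|exact: IHn].
- by rewrite -[X in measurable X]setTI; apply: measurable_funD.
- by rewrite -[X in measurable X]setTI; apply: measurable_shift_rV.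
Qed.


Lemma measurable_lebesgue (R : realType) n (A : set 'rV[R]_n) :
  measurable A -> lebesgue_measurable A.
Proof. exact: caratheodory_measurable_mu_ext. Qed.

Lemma lebesgue_rV_borel (R : realType) n (A : set 'rV[R]_n) :
  measurable A -> lebesgue_rV R n A = borel_lebesgue n A.
Proof. exact: measurable_mu_extE. Qed.

(** Translating a Borel cover of A gives a cover of the same cost. The set is arbitrary because
    Caratheodory measurability of a translate is tested on all sets. *)
Lemma lebesgue_rV_shift (R : realType) n (a : 'rV[R]_n) (A : set 'rV[R]_n) :
  lebesgue_rV R n ((fun x => x + a) @^-1` A) = lebesgue_rV R n A.
Proof.
suff shift_le (b : 'rV[R]_n) (B : set 'rV[R]_n) :
    (lebesgue_rV R n ((fun x => x + b)%R @^-1` B) <= lebesgue_rV R n B)%E.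
  apply/eqP; rewrite eq_le shift_le /=.
  rewrite [leLHS](_ : _ = lebesgue_rV R n
    ((fun x => x - a) @^-1` ((fun x => x + a) @^-1` A))); last first.
    by congr lebesgue_rV; apply/seteqP; split => x; rewrite /preimage /= subrK.
  exact: shift_le.
rewrite /lebesgue_rV /completed_measure_extension /mu_ext.
apply: le_ereal_inf_tmp => _ [F [mF BF] <-].
apply: ereal_inf_lbound; exists (fun k => (fun x => x + b) @^-1` F k).
  split => [k|x /BF [k _ Fk]]; last by exists k.
  by rewrite -[X in measurable X]setTI; exact: measurable_shift_rV.
by apply: eq_eseriesr => k _; exact: borel_lebesgue_shift.
Qed.

(** A test set X is replaced by its preimage under [g], cut by A there, and the pieces are brought
    back by the invariance of [mu]. *)
Lemma caratheodory_preimage (R : realType) (T : Type) (mu : set T -> \bar R)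
    (f g : T -> T) (A : set T) :
  cancel g f -> (forall Y, mu (g @^-1` Y) = mu Y) ->
  caratheodory_measurable mu A -> caratheodory_measurable mu (f @^-1` A).
Proof.
move=> gf mug mA X; rewrite -(mug X) (mA (g @^-1` X)).
have K Y : g @^-1` (f @^-1` Y) = Y.
  by apply/seteqP; split => x; rewrite /preimage /= gf.
by rewrite -[in RHS](mug (X `&` _)) -[X in _ = (_ + X)%E]mug
  !preimage_setI preimage_setC !K.
Qed.

Lemma measurable_shift_cara (R : realType) n (a : 'rV[R]_n) :
  measurable_fun setT (fun x : cara R n => x + a : cara R n).
Proof.
move=> _ A mA; rewrite setTI.
apply: (@caratheodory_preimage _ _ _ (fun x => x + a) (fun x => x - a) A _ _ mA).
  by move=> x; rewrite subrK.
by move=> Y; exact: (lebesgue_rV_shift (- a) Y).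
Qed.

Lemma continuous_measurable_cara (R : realType) n (f : 'rV[R]_n -> R) :
  continuous f -> measurable_fun setT (f : cara R n -> R).
Proof.
move=> cf; apply: (measurability _ (RGenOpens.measurableE R)).
move=> _ [_ [a [b ->]] <-].
rewrite setTI.
have : open (f @^-1` `]a, b[%classic).
  by apply: open_comp => [x _|]; [exact: cf|exact: interval_open].
by move=> /open_rV_measurable /measurable_lebesgue.
Qed.

(** * Integration over row vectors *)

Lemma integral_measure_preserving d d' (T : measurableType d) (T' : measurableType d')
    (R : realType) (m : {measure set T -> \bar R}) (m' : {measure set T' -> \bar R})
    (phi : T -> T') (mphi : measurable_fun setT phi) (D : set T') (f : T' -> \bar R) :
  (forall A, measurable A -> m (phi @^-1` A) = m' A) ->
  measurable D -> measurable_fun setT f -> m.-integrable (phi @^-1` D) (f \o phi) ->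
  (\int[m]_(x in phi @^-1` D) (f \o phi) x = \int[m']_(x in D) f x)%E.
Proof.
move=> mm mD mf intf; rewrite -(integral_pushforward mphi mf intf mD).
pose mu := measure_function_pushforward__canonical__measure_function_Measure m mphi.
by apply: (@eq_measure_integral _ _ _ D m' mu) => A mA _; exact: mm.
Qed.

Lemma ge0_integral_measure_preserving d d' (T : measurableType d)
    (T' : measurableType d')
    (R : realType) (m : {measure set T -> \bar R}) (m' : {measure set T' -> \bar R})
    (phi : T -> T') (mphi : measurable_fun setT phi) (f : T' -> \bar R) :
  (forall A, measurable A -> m (phi @^-1` A) = m' A) ->
  measurable_fun setT f -> (forall x, 0 <= f x)%E ->
  (\int[m]_x (f \o phi) x = \int[m']_x f x)%E.
Proof.
move=> mm mf f0.
rewrite -[X in (\int[_]_(x in X) _)%E](preimage_setT phi) -ge0_integral_pushforward//.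
pose mu := measure_function_pushforward__canonical__measure_function_Measure m mphi.
by apply: (@eq_measure_integral _ _ _ setT m' mu) => A mA _; exact: mm.
Qed.

Lemma integral_shift_rV (R : realType) n (a : 'rV[R]_n) (D : set 'rV[R]_n)
    (f : 'rV[R]_n -> \bar R) :
  lebesgue_measurable D -> measurable_fun setT (f : cara R n -> \bar R) ->
  (lebesgue_rV R n).-integrable ((fun x => x + a) @^-1` D) (fun x => f (x + a)) ->
  (\int[lebesgue_rV R n]_(x in (fun x => x + a)%R @^-1` D) f (x + a)%R =
   \int[lebesgue_rV R n]_(x in D) f x)%E.
Proof.
move=> mD mf intf.
apply: (@integral_measure_preserving _ _ (cara R n) (cara R n) R (lebesgue_rV R n)
  (lebesgue_rV R n) _ (measurable_shift_cara a) D f _ mD mf intf).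
by move=> A _; exact: lebesgue_rV_shift.
Qed.

Lemma ge0_integral_lebesgue_borel (R : realType) n (f : 'rV[R]_n -> \bar R) :
  measurable_fun setT f -> (forall x, 0 <= f x)%E ->
  (\int[lebesgue_rV R n]_x f x = \int[borel_lebesgue n]_x f x)%E.
Proof.
move=> mf f0.
(* The identity, seen as a measure preserving map from the completed sigma-algebra to the Borel
   one. *)
have mid : measurable_fun setT (fun x : cara R n => x : 'rV[R]_n).
  by move=> _ A mA; rewrite setTI; exact: measurable_lebesgue.
apply: (@ge0_integral_measure_preserving _ _ (cara R n) 'rV[R]_n R (lebesgue_rV R n)
  (borel_lebesgue n) _ mid f _ mf f0).
by move=> A mA; exact: lebesgue_rV_borel.
Qed.

(** Tonelli on the first coordinate: the inner integral is [g 0 t] times the constant that the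
    induction hypothesis gives for the other coordinates. *)
Lemma integral_prod_borel (R : realType) n (g : 'I_n -> R -> R) (c : 'I_n -> R) :
  (forall i, measurable_fun setT (g i)) -> (forall i t, 0 <= g i t) ->
  (forall i, \int[lebesgue_measure]_t (g i t)%:E = (c i)%:E)%E ->
  (\int[borel_lebesgue n]_x (\prod_i g i (x 0 i))%:E = (\prod_i c i)%:E)%E.
Proof.
elim: n g c => [|n IHn] g c mg g0 gc.
  rewrite big_ord0 /= /lebesgue_rV0.
  under eq_integral do rewrite big_ord0.
  by rewrite integral_cst//= diracT mule1.
have mpi k (h : 'I_k -> R -> R) : (forall i, measurable_fun setT (h i)) ->
    measurable_fun setT (fun x : 'rV[R]_k => \prod_i h i (x 0 i)).
  move=> mh; apply: measurable_prod => i _.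
  exact: (measurableT_comp (mh i) (@measurable_rV_coord R k i)).
have pi0 k (h : 'I_k -> R -> R) (x : 'rV[R]_k) : (forall i t, 0 <= h i t) ->
    0 <= \prod_i h i (x 0 i).
  by move=> h0; apply: prodr_ge0 => i _; exact: h0.
rewrite /= /lebesgue_rV_step.
rewrite (ge0_integral_pushforward (@measurable_rV_cons R n)) //=; last 2 first.
  by apply/measurable_EFinP; exact: (mpi _ _ mg).
  by move=> x _; rewrite lee_fin pi0.
rewrite preimage_setT.
have consE (t : R) (y : 'rV[R]_n) : \prod_i g i (rV_cons (t, y) 0 i) =
    g 0 t * \prod_i g (lift 0 i) (y 0 i).
  rewrite big_ord_recl; congr (g _ _ * _).
    transitivity (row_mx t%:M y 0 (lshift n (0 : 'I_1))).
      by congr (row_mx _ _ _ _); exact/val_inj.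
    by rewrite row_mxEl mxE eqxx.
  apply: eq_bigr => i _; congr (g _ _).
  transitivity (row_mx t%:M y 0 (rshift 1 i)); last by rewrite row_mxEr.
  by congr (row_mx _ _ _ _); exact/val_inj.
rewrite fubini_tonelli1 /=; last 2 first.
  apply/measurable_EFinP.
  exact: (measurableT_comp (mpi _ _ mg) (@measurable_rV_cons R n)).
  by move=> x; rewrite lee_fin pi0.
transitivity (\int[lebesgue_measure]_t ((\prod_i c (lift 0 i))%:E * (g 0 t)%:E))%E.
  apply: eq_integral => t _; rewrite /fubini_F.
  rewrite -(IHn (fun i => g (lift 0 i)) (fun i => c (lift 0 i)))// [RHS]muleC.
  rewrite -ge0_integralZl//=; last 3 first.
  - by apply/measurable_EFinP; exact: (mpi _ (fun i => g (lift 0 i))).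
  - by move=> x _; rewrite lee_fin; exact: (pi0 _ (fun i => g (lift 0 i))).
  - by rewrite lee_fin; exact: g0.
  by apply: eq_integral => y _; rewrite consE EFinM.
rewrite ge0_integralZl//=.
- by rewrite gc -EFinM big_ord_recl mulrC.
- by apply/measurable_EFinP; exact: mg.
- by move=> x _; rewrite lee_fin; exact: g0.
- rewrite lee_fin; apply: prodr_ge0 => i _; rewrite -lee_fin -gc.
  by apply: integral_ge0 => x _; rewrite lee_fin; exact: g0.
Qed.

Lemma integral_prod_rV (R : realType) n (g : 'I_n -> R -> R) (c : 'I_n -> R) :
  (forall i, measurable_fun setT (g i)) -> (forall i t, 0 <= g i t) ->
  (forall i, \int[lebesgue_measure]_t (g i t)%:E = (c i)%:E)%E ->
  (\int[lebesgue_rV R n]_x (\prod_i g i (x 0 i))%:E = (\prod_i c i)%:E)%E.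
Proof.
move=> mg g0 gc; rewrite ge0_integral_lebesgue_borel.
- exact: integral_prod_borel.
- apply/measurable_EFinP; apply: measurable_prod => i _.
  exact: (measurableT_comp (mg i) (@measurable_rV_coord R n i)).
- by move=> x; rewrite lee_fin; apply: prodr_ge0.
Qed.

Definition cube (R : realType) n (p : 'rV[R]_n) (r : R) : set 'rV[R]_n :=
  [set x | forall i, `|x 0 i - p 0 i| < r].

Lemma measurable_cube (R : realType) n (p : 'rV[R]_n) (r : R) :
  measurable (cube p r).
Proof.
rewrite (_ : cube p r = [set x | forall i, `]p 0 i - r, p 0 i + r[%classic (x 0 i)]).
  exact: (@measurable_box R n (fun i => `]p 0 i - r, p 0 i + r[%classic)).
by apply/seteqP; split => x xp i; have := xp i; rewrite /= in_itv /= ltr_distl.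
Qed.

(** The indicator of the cube is the product of the indicators of its edges, so this is an instance
    of [integral_prod_rV]. *)
Lemma lebesgue_rV_cube (R : realType) n (p : 'rV[R]_n) (r : R) : 0 < r ->
  lebesgue_rV R n (cube p r) = ((r *+ 2) ^+ n)%:E.
Proof.
move=> r0; pose I i : set R := `]p 0 i - r, p 0 i + r[%classic.
have cI x : cube p r x <-> forall i, I i (x 0 i).
  by split => xp i; have := xp i; rewrite /I /= in_itv /= ltr_distl.
have mI i : measurable (I i) by exact: measurable_itv.
have := @integral_prod_rV R n (fun i => \1_(I i)) (fun=> r *+ 2).
rewrite prodr_const card_ord => <-.
- have mQ : lebesgue_measurable (cube p r).
    by apply: measurable_lebesgue; exact: measurable_cube.
  rewrite -[in LHS](setIT (cube p r)) -integral_indic//.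
  apply: eq_integral => x _; congr EFin; rewrite indicE.
  have [xQ|xQ] := pselect (cube p r x).
    rewrite mem_set//.
    by rewrite big1// => i _; rewrite indicE mem_set//; exact: (cI x).1.
  rewrite memNset//; apply/esym/eqP; rewrite prodf_seq_eq0.
  apply: contra_notT xQ => /hasPn xQ.
  apply/cI => i; have := xQ i (mem_index_enum i).
  by rewrite /= indicE; have [/set_mem|_ /eqP] := boolP (x 0 i \in I i).
- by move=> i; exact: measurable_indic.
- by move=> i t; rewrite indicE.
- move=> i; rewrite integral_indic; [|exact: measurableT|exact: mI].
  rewrite setIT; apply: (etrans (lebesgue_measure_itv `]p 0 i - r, p 0 i + r[)).
  rewrite /= lte_fin.
  by rewrite ltrD2l gtrN// -?EFinB; congr EFin; ring.
Qed.

(** On each interval [-k, k] the integral is F k - F (- k), at most b - a; monotone convergence does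
    the rest. The primitives in view are arctangents. *)
Lemma integral_derive_monotone_le (R : realType) (F f : R -> R) (a b : R) :
  (forall t : R, is_derive t (1 : R) F (f t)) -> continuous f -> (forall t, 0 <= f t) ->
  (forall t, a <= F t <= b) ->
  (\int[lebesgue_measure]_t (f t)%:E <= (b - a)%:E)%E.
Proof.
move=> dF cf f0 Fab.
have mf : measurable_fun setT f by exact: continuous_measurable_fun.
pose I (k : nat) : set R := `[- k.+1%:R, k.+1%:R]%classic.
have IT : \bigcup_k I k = setT.
  apply/seteqP; split => // x _; exists (Num.truncn `|x|) => //=.
  by rewrite /I /= in_itv /= -ler_norml ltW// truncnS_gt.
have nd : nondecreasing_seq I.
  move=> i j ij; rewrite subsetEset => x; rewrite /I /= !in_itv /= -!ler_norml => xi.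
  by rewrite (le_trans xi)// ler_nat.
have mfI k : measurable_fun (I k) (fun t => (f t)%:E).
  by apply: measurable_funTS; exact/measurable_EFinP.
have cvgI : (\int[lebesgue_measure]_(t in I k) (f t)%:E @[k --> \oo] -->
    \int[lebesgue_measure]_(t in \bigcup_k I k) (f t)%:E)%E.
  apply: ge0_nondecreasing_set_cvg_integral => //.
  - by move=> k; exact: measurable_itv.
  - by move=> k x _; rewrite lee_fin.
rewrite -IT; apply: (cvge_to_le cvgI).
apply: nearW => k.
have kk : (- k.+1%:R : R) < k.+1%:R by rewrite gtrN.
rewrite (@continuous_FTC2 _ f F)//.
- by rewrite -EFinB lee_fin; apply: lerB; [have /andP[] := Fab k.+1%:R|
    have /andP[] := Fab (- k.+1%:R)].
- by apply: continuous_subspaceT => x; exact: cf.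
- have cF : continuous F.
    by move=> x; apply/differentiable_continuous/derivable1_diffP; have [] := dF x.
  split.
  + by move=> x _; have [] := dF x.
  + by apply: cvg_at_right_filter; exact: cF.
  + by apply: cvg_at_left_filter; exact: cF.
- by move=> x _; rewrite derive1E; have [] := dF x.
Qed.

(** * Smooth functions *)

(* Indexing smoothness by the order of differentiation makes closure under
   products and inverses a plain induction. *)
Fixpoint smooth_upto (R : realType) n (k : nat) (f : 'rV[R]_n -> R) : Prop :=
  continuous f /\ if k is k'.+1
    then forall i, (forall x, derivable f x (delta_mx 0 i)) /\
                   smooth_upto k' (partial i f)
    else True.

Lemma smooth_upto_continuous (R : realType) n k (f : 'rV[R]_n -> R) :
  smooth_upto k f -> continuous f.
Proof. by case: k => [|k] []. Qed.

Lemma smooth_uptoP (R : realType) n (f : 'rV[R]_n -> R) :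
  smooth f <-> forall k, smooth_upto k f.
Proof.
split=> [sf k|sf s].
  elim: k f sf => [|k IHk] f sf; first by split => //; have [] := sf [::].
  split; first by have [] := sf [::].
  move=> i; split; first by move=> x; have [_] := sf [::]; apply.
  by apply: IHk => s; have := sf (rcons s i); rewrite foldr_rcons.
elim/last_ind: s f sf => [|s i IHs] f sf.
  by split; [have [] := sf 0%N|move=> i x; have [_ /(_ i)[]] := sf 1%N].
rewrite foldr_rcons; apply: IHs => k.
by have [_ /(_ i)[]] := sf k.+1.
Qed.

Section smooth_upto.
Context {R : realType} {n : nat}.
Implicit Types (f g : 'rV[R]_n -> R) (k : nat).

Lemma smooth_uptoW k f : smooth_upto k.+1 f -> smooth_upto k f.
Proof.
elim: k f => [|k IHk] f [cf df]; first by split.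
by split => // i; have [? ?] := df i; split => //; exact: IHk.
Qed.

Lemma smooth_upto_cst k (c : R) : smooth_upto k (fun _ : 'rV[R]_n => c).
Proof.
elim: k c => [|k IHk] c; first by split => // x; exact: cst_continuous.
split; first by move=> x; exact: cst_continuous.
move=> i; split; first by move=> x; exact: derivable_cst.
rewrite (_ : partial i _ = fun=> 0); first exact: IHk.
by apply/funext => x; exact: derive_cst.
Qed.

Lemma smooth_uptoD k f g :
  smooth_upto k f -> smooth_upto k g -> smooth_upto k (fun x => f x + g x).
Proof.
elim: k f g => [|k IHk] f g [cf df] [cg dg].
  by split => // x; exact: (cvgD (cf x) (cg x)).
split; first by move=> x; exact: (cvgD (cf x) (cg x)).
move=> i; have [{}df sf] := df i; have [{}dg sg] := dg i; split.
  by move=> x; exact: derivableD.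
rewrite (_ : partial i _ = fun x => partial i f x + partial i g x); first exact: IHk.
by apply/funext => x; exact: deriveD.
Qed.

Lemma smooth_uptoM k f g :
  smooth_upto k f -> smooth_upto k g -> smooth_upto k (fun x => f x * g x).
Proof.
elim: k f g => [|k IHk] f g sf sg;
  have cf := smooth_upto_continuous sf; have cg := smooth_upto_continuous sg.
  by split => // x; exact: (continuousM (cf x) (cg x)).
split; first by move=> x; exact: (continuousM (cf x) (cg x)).
have sfk := smooth_uptoW sf; have sgk := smooth_uptoW sg.
move: sf sg => [_ df] [_ dg] i; have [{}df sf] := df i; have [{}dg sg] := dg i.
split; first by move=> x; exact: derivableM.
rewrite (_ : partial i _ = fun x => f x * partial i g x + g x * partial i f x).
  by apply: smooth_uptoD; exact: IHk.
by apply/funext => x; exact: deriveM.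
Qed.

Lemma smooth_uptoV k f : (forall x, f x != 0) ->
  smooth_upto k f -> smooth_upto k (fun x => (f x)^-1).
Proof.
move=> f0; elim: k f f0 => [|k IHk] f f0 sf; have cf := smooth_upto_continuous sf.
  by split => // x; exact: (continuousV (f0 x) (cf x)).
split; first by move=> x; exact: (continuousV (f0 x) (cf x)).
have sfk := smooth_uptoW sf.
move: sf => [_ df] i; have [{}df sf] := df i.
split; first by move=> x; exact: derivableV.
(* Written with products only: the induction hypothesis covers the inverse of [f] at the lower
   order, and [smooth_uptoM] combines the factors. *)
rewrite (_ : partial i _ = fun x => - 1 * (((f x)^-1 * (f x)^-1) * partial i f x)).
  apply: smooth_uptoM; first exact: smooth_upto_cst.
  by apply: smooth_uptoM => //; apply: smooth_uptoM; exact: IHk.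
apply/funext => x; rewrite /partial deriveV//.
by rewrite /GRing.scale /= expr2 invfM mulN1r mulNr.
Qed.

Lemma is_derive_coord (i j : 'I_n) (x : 'rV[R]_n) :
  is_derive x (delta_mx 0 i) (fun y : 'rV[R]_n => y 0 j) ((i == j)%:R : R).
Proof.
have cvgq : h^-1 *: (((fun y : 'rV[R]_n => y 0 j) \o shift x)
    (h *: (delta_mx 0 i : 'rV[R]_n)) - x 0 j) @[h --> (0 : R)^'] --> ((i == j)%:R : R).
  apply: cvg_near_cst; near=> h.
  rewrite /= !mxE eqxx /= addrK /GRing.scale /= mulrA mulVf ?mul1r ?[j == i]eq_sym//.
  by near: h; exact: nbhs_dnbhs_neq.
by split; [apply/cvg_ex; exists (i == j)%:R|apply/cvg_lim].
Unshelve. all: by end_near. Qed.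

Lemma smooth_upto_coord k (j : 'I_n) : smooth_upto k (fun x : 'rV[R]_n => x 0 j).
Proof.
case: k => [|k]; first by split => //; exact: coord_continuous.
split; first exact: coord_continuous.
move=> i; split; first by move=> x; have [] := is_derive_coord i j x.
rewrite (_ : partial i _ = fun=> (i == j)%:R); first exact: smooth_upto_cst.
by apply/funext => x; have [_] := is_derive_coord i j x.
Qed.

Lemma smooth_upto_exp k m f : smooth_upto k f -> smooth_upto k (fun x => f x ^+ m).
Proof.
move=> sf; elim: m => [|m IHm]; first exact: smooth_upto_cst.
rewrite (_ : (fun x => _) = fun x => f x * f x ^+ m); first exact: smooth_uptoM.
by apply/funext => x; rewrite exprS.
Qed.

Lemma smooth_upto_prod (I : Type) (s : seq I) k (F : I -> 'rV[R]_n -> R) :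
  (forall i, smooth_upto k (F i)) -> smooth_upto k (fun x => \prod_(i <- s) F i x).
Proof.
move=> sF; elim: s => [|i s IHs].
  rewrite (_ : (fun x => _) = fun=> 1); first exact: smooth_upto_cst.
  by apply/funext => x; rewrite big_nil.
rewrite (_ : (fun x => _) = fun x => F i x * \prod_(i <- s) F i x).
  exact: smooth_uptoM.
by apply/funext => x; rewrite big_cons.
Qed.

Lemma derive_shift f (a x v : 'rV[R]_n) :
  'D_v (fun y => f (y + a)) x = 'D_v f (x + a).
Proof.
rewrite /derive [X in lim (X @ _) = _](_ : _ =
  fun h : R => h^-1 *: ((f \o shift (x + a)) (h *: v) - f (x + a)))//.
by apply/funext => h /=; rewrite addrA.
Qed.

Lemma derivable_shift f (a x v : 'rV[R]_n) :
  derivable f (x + a) v -> derivable (fun y => f (y + a)) x v.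
Proof.
rewrite /derivable => df.
rewrite [X in cvg (X @ _)](_ : _ =
  fun h : R => h^-1 *: ((f \o shift (x + a)) (h *: v) - f (x + a)))//.
by apply/funext => h /=; rewrite addrA.
Qed.

Lemma continuous_shift f (a : 'rV[R]_n) :
  continuous f -> continuous (fun y : 'rV[R]_n => f (y + a)).
Proof.
move=> cf x; apply: continuous_comp; last exact: cf.
exact: (cvgD cvg_id (cvg_cst a)).
Qed.

Lemma smooth_upto_shift k f (a : 'rV[R]_n) :
  smooth_upto k f -> smooth_upto k (fun y => f (y + a)).
Proof.
elim: k f => [|k IHk] f [cf df]; first by split => //; exact: continuous_shift.
split; first exact: continuous_shift.
move=> i; have [{}df sf] := df i; split.
  by move=> x; exact: derivable_shift.
rewrite (_ : partial i _ = fun x => partial i f (x + a)); first exact: IHk.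
by apply/funext => x; exact: derive_shift.
Qed.

End smooth_upto.

(** * Functions with bounded support *)

Lemma integrable_scaled_indic d (T : measurableType d) (R : realType)
    (m : {measure set T -> \bar R}) (A : set T) (K : R) : 0 <= K ->
  measurable A -> (m A < +oo)%E ->
  m.-integrable setT (fun x => (K * \1_A x)%:E).
Proof.
move=> K0 mA mAoo; apply/integrableP; split.
  by apply/measurable_EFinP; apply: measurable_funM => //; exact: measurable_indic.
under eq_integral => x _ do rewrite abse_EFin ger0_norm ?mulr_ge0// EFinM.
rewrite ge0_integralZl//; last by apply/measurable_EFinP; exact: measurable_indic.
by rewrite integral_indic// setIT lte_mul_pinfty.
Qed.

Section bounded_support.
Context {R : realType} {n : nat}.
Implicit Types (f g : 'rV[R]_n -> R).
Local Notation mu := (lebesgue_rV R n).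

Definition bounded_support f := exists M : R, forall x, M < `|x| -> f x = 0.

Lemma continuous_bounded_support f : continuous f -> bounded_support f ->
  exists2 K, 0 <= K & forall x, `|f x| <= K.
Proof.
move=> cf [M fM].
pose B := [set x : 'rV[R]_n | `|x| <= M].
have cB : compact B.
  apply: bounded_closed_compact.
    exists M; split; first exact: num_real.
    by move=> N MN x /= xM; rewrite (le_trans xM)// ltW.
  rewrite (_ : B = (fun x : 'rV[R]_n => `|x|) @^-1` [set y | y <= M])//.
  by apply: preimage_closed => // x _; exact: norm_continuous.
have : compact (f @` B).
  by apply: continuous_compact => //; exact: continuous_subspaceT.
move=> /compact_bounded [K0 [_ K0f]].
pose K := Num.max 0 (K0 + 1).
have K00 : 0 <= K by rewrite le_max lexx.
exists K => // x.
have [xM|Mx] := leP `|x| M; last by rewrite fM// normr0.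
by apply: (K0f K _ (f x)); [rewrite lt_max ltrDl ltr01 orbT|exists x].
Qed.

Lemma norm_lt_cube (x : 'rV[R]_n) (r : R) : `|x| < r -> cube 0 r x.
Proof. by move=> xr i; rewrite mxE subr0 (le_lt_trans (ler_coord_norm _ _)). Qed.

Lemma integrable_indic_cube (p : 'rV[R]_n) (K r : R) : 0 <= K -> 0 < r ->
  mu.-integrable setT (fun x => (K * \1_(cube p r) x)%:E).
Proof.
move=> K0 r0; apply: integrable_scaled_indic => //.
  by apply: measurable_lebesgue; exact: measurable_cube.
suff : (lebesgue_rV R n (cube p r) < +oo)%E by [].
by rewrite lebesgue_rV_cube// ltry.
Qed.

(** Source of the integrable majorants. The half-side [Num.max M 0 + 1] is positive whatever the
    sign of M and exceeds M, so points outside the open cube have norm above M. *)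
Lemma le_indic_cube f (K M : R) : 0 <= K -> (forall x, `|f x| <= K) ->
    (forall x, M < `|x| -> f x = 0) ->
  forall x, `|f x| <= K * \1_(cube (0 : 'rV[R]_n) (Num.max M 0 + 1)) x.
Proof.
move=> K0 fK fM x; have [xQ|xQ] := pselect (cube 0 (Num.max M 0 + 1) x).
  by rewrite indicE mem_set// mulr1.
rewrite indicE memNset// mulr0 fM ?normr0//.
rewrite ltNge; apply/negP => xM; apply/xQ/norm_lt_cube.
by rewrite (le_lt_trans xM)// (@le_lt_trans _ _ (Num.max M 0))// ?le_max ?lexx// ltrDl.
Qed.

Lemma integrable_bounded_support f : continuous f -> bounded_support f ->
  mu.-integrable setT (fun x => (f x)%:E).
Proof.
move=> cf bf; have [K K0 fK] := continuous_bounded_support cf bf.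
have [M fM] := bf.
have r0 : 0 < Num.max M 0 + 1 by rewrite ltr_wpDl// le_max lexx orbT.
apply: (le_integrable measurableT _ _ (integrable_indic_cube 0 K0 r0)).
- by apply/measurable_EFinP; exact: continuous_measurable_cara.
- move=> x _; rewrite !abse_EFin lee_fin.
  by apply: le_trans (le_indic_cube K0 fK fM x) (ler_norm _).
Qed.

Lemma is_derive_line f (x v : 'rV[R]_n) (t : R) : derivable f (x + t *: v) v ->
  is_derive t (1 : R) (fun s : R => f (x + s *: v)) ('D_v f (x + t *: v)).
Proof.
move=> df.
have E : (fun h : R => h^-1 *:
    (((fun s : R => f (x + s *: v)) \o shift t) (h *: (1 : R)) - f (x + t *: v))) =
  (fun h : R => h^-1 *: ((f \o shift (x + t *: v)) (h *: v) - f (x + t *: v))).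
  apply/funext => h /=; congr (_ *: (f _ - _)).
  by rewrite scalerDl addrCA /GRing.scale /= mulr1.
by split; rewrite /derivable/derive E.
Qed.

(** Mean value theorem along the segment; it bounds difference quotients uniformly in the step, as
    dominated convergence requires. *)
Lemma derive_lipschitz f (x v : 'rV[R]_n) (K t : R) : 0 <= t ->
  (forall y, derivable f y v) -> (forall y, `|'D_v f y| <= K) ->
  `|f (x + t *: v) - f x| <= K * t.
Proof.
move=> t0 df dK.
have D s := is_derive_line (df (x + s *: v)).
have cD : {within `[0, t], continuous (fun s => f (x + s *: v))}.
  apply: continuous_subspaceT => s.
  by apply/differentiable_continuous/derivable1_diffP; have [] := D s.
have [c _] := MVT_segment t0 (fun s _ => D s) cD.
rewrite scale0r addr0 subr0 => ->.
by rewrite normrM (ger0_norm t0) ler_wpM2r.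
Qed.

(** The condition M < |x| is open, so near such an x the difference quotients vanish for small
    steps. *)
Lemma derive_bounded_support f v : bounded_support f ->
  bounded_support (fun x => 'D_v f x).
Proof.
move=> [M fM]; exists M => x Mx.
rewrite /derive; apply: cvg_lim => //; apply: cvg_near_cst.
rewrite /= (fM x Mx).
have : \forall h \near (0 : R)^', M < `|h *: v + x|.
  have C : `|h *: v + x| @[h --> (0 : R)] --> `|0 *: v + x|.
    apply: cvg_norm; apply: cvgD; last exact: cvg_cst.
    by apply: cvgZr_tmp; exact: cvg_id.
  apply: nbhs_dnbhs; apply: (cvgr_gt _ C).
  by rewrite scale0r add0r.
by apply: filterS => h hM; rewrite fM// subr0 scaler0.
Qed.

(* The difference quotients of [f] have integral 0 by translation invariance, and
   they converge dominatedly to the derivative. *)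
Lemma integral_derive_eq0 f (v : 'rV[R]_n) :
  continuous f -> (forall x, derivable f x v) -> continuous (fun x => 'D_v f x) ->
  bounded_support f -> (\int[mu]_x ('D_v f x)%:E = 0)%E.
Proof.
move=> cf df cdf bf.
have [K K0 dK] := continuous_bounded_support cdf (derive_bounded_support v bf).
have [M fM] := bf.
pose h (k : nat) : R := k.+1%:R^-1.
have h0 k : 0 < h k by rewrite invr_gt0.
have h1 k : h k <= 1 by rewrite invf_le1// ler1n.
pose F k (x : 'rV[R]_n) := (h k)^-1 * (f (x + h k *: v) - f x).
have cF k : continuous (F k).
  have cs : continuous (fun x : 'rV[R]_n => f (x + h k *: v)) by exact: continuous_shift.
  have cc : continuous (fun _ : 'rV[R]_n => (h k)^-1) by move=> x; exact: cst_continuous.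
  by move=> x; exact: (continuousM (cc x) (continuousB (cs x) (cf x))).
(* The steps [h k] are at most 1, so enlarging M by |v| serves all k at once. *)
have bF k x : M + `|v| < `|x| -> F k x = 0.
  move=> Mx; rewrite /F !fM ?subrr ?mulr0//.
    by rewrite (le_lt_trans _ Mx)// lerDl.
  have := ler_normB (x + h k *: v) (h k *: v).
  rewrite addrK normrZ (ger0_norm (ltW (h0 k))) => xv.
  have : h k * `|v| <= `|v| by rewrite ler_piMl.
  lra.
have FK k x : `|F k x| <= K.
  have hk := ltW (h0 k); rewrite /F normrM ger0_norm ?invr_ge0//.
  by rewrite ler_pdivrMl// mulrC; exact: derive_lipschitz.
have F0 k : (\int[mu]_x (F k x)%:E = 0)%E.
  under eq_integral do rewrite /F EFinM EFinB.
  have i1 := integrable_bounded_support cf bf.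
  have i2 : mu.-integrable setT (fun x => (f (x + h k *: v))%:E).
    apply: (@integrable_bounded_support (fun x => f (x + h k *: v))).
      exact: continuous_shift.
    exists (M + `|v|) => x Mx; apply: fM.
    have := ler_normB (x + h k *: v) (h k *: v).
    rewrite addrK normrZ (ger0_norm (ltW (h0 k))) => xv.
    have : h k * `|v| <= `|v| by rewrite ler_piMl.
    lra.
  rewrite integralZl//; last exact: integrableB.
  rewrite integralB//.
  rewrite (_ : \int[mu]_x (f (x + h k *: v)%R)%:E = \int[mu]_x (f x)%:E)%E.
    rewrite subee ?mule0; first by [].
    exact: (integrable_fin_num measurableT i1).
  have mf : measurable_fun setT ((fun x => (f x)%:E) : cara R n -> \bar R).
    by apply/measurable_EFinP; exact: continuous_measurable_cara.
  have := @integral_shift_rV R n (h k *: v) setT (fun x => (f x)%:E) measurableT mf.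
  by rewrite preimage_setT => /(_ i2).
have [] := @dominated_convergence _ _ _ mu setT measurableT
  (fun k x => (F k x)%:E) (fun x => ('D_v f x)%:E)
  (fun x => (K * \1_(cube (0 : 'rV[R]_n) (Num.max (M + `|v|) 0 + 1)) x)%:E).
- by move=> k; apply/measurable_EFinP; exact: continuous_measurable_cara.
- by apply/measurable_EFinP; exact: continuous_measurable_cara.
- apply: aeW => x _; apply: cvg_EFin; first exact: nearW.
  rewrite (_ : fine \o _ =
      (fun h : R => h^-1 *: ((f \o shift x) (h *: v) - f x)) \o h); last first.
    by apply/funext => k /=; rewrite /F [x + _]addrC.
  have /cvgr_dnbhsP : h^-1 *: ((f \o shift x) (h *: v) - f x)
      @[h --> (0 : R)^'] --> 'D_v f x.
    exact: df.
  apply; split; first by move=> k; rewrite gt_eqF.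
  exact: cvg_harmonic.
- by apply: integrable_indic_cube => //; rewrite ltr_wpDl// le_max lexx orbT.
- apply: aeW => x k _; rewrite abse_EFin lee_fin.
  exact: (le_indic_cube K0 (FK k) (bF k)).
move=> _ _; rewrite (_ : (fun k => _) = fun=> 0%E); last by apply/funext => k; exact: F0.
by move=> /cvg_unique; apply => //; exact: cvg_cst.
Qed.

End bounded_support.

(** * Test fields and perimeter *)

(** The integrals of [b] over E and over its complement cancel, which leaves the integral of [a]
    over E minus that of [g] over the complement. *)
Lemma le_integral_cutoff d (T : measurableType d) (R : realType)
    (m : {measure set T -> \bar R}) (E : set T) (a b g : T -> R) :
  measurable E -> m.-integrable setT (EFin \o a) -> m.-integrable setT (EFin \o b) ->
  m.-integrable setT (EFin \o g) -> (\int[m]_x (b x)%:E = 0)%E ->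
  (\int[m]_(x in E) (a x + b x)%:E + \int[m]_(x in ~` E) (b x - g x)%:E <=
   \int[m]_(x in E) (a x)%:E + \int[m]_x `|g x|%:E)%E.
Proof.
move=> mE ia ib ig b0.
have mEC : measurable (~` E) by exact: measurableC.
have sub (D : set T) f : measurable D -> m.-integrable setT f -> m.-integrable D f.
  by move=> mD; exact: integrableS.
rewrite integralD_EFin//; [|exact: sub|exact: sub].
rewrite integralB_EFin//; [|exact: sub|exact: sub].
have bE : (\int[m]_(x in E) (b x)%:E + \int[m]_(x in ~` E) (b x)%:E = 0)%E.
  rewrite -integral_setU //; first by rewrite setUv.
    by rewrite setUv; exact: (measurable_int _ ib).
  by apply/disj_setPS; rewrite setICr.
have fa := integrable_fin_num mE (sub _ _ mE ia).
have fb := integrable_fin_num mE (sub _ _ mE ib).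
have fbC := integrable_fin_num mEC (sub _ _ mEC ib).
have fg := integrable_fin_num mEC (sub _ _ mEC ig).
rewrite -addeA leeD2lE// addeA bE add0e.
apply: (@le_trans _ _ (\int[m]_(x in ~` E) `|g x|%:E)%E).
  apply: (@le_trans _ _ `|\int[m]_(x in ~` E) (g x)%:E|%E).
    by rewrite -abseN lee_abs.
  by apply: le_abse_integral => //; exact: (measurable_int _ (sub _ _ mEC ig)).
apply: ge0_subset_integral => //.
apply/measurable_EFinP; apply: measurableT_comp => //.
by have := measurable_int _ ig; move/measurable_EFinP.
Qed.

Section test_fields.
Context {R : realType} {n : nat}.
Implicit Types (f g phi : 'rV[R]_n -> R) (xi eta : 'rV[R]_n -> 'rV[R]_n).
Implicit Types (C E : set 'rV[R]_n).
Local Notation mu := (lebesgue_rV R n).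

Lemma smooth_continuous f : smooth f -> continuous f.
Proof. by move=> sf; have [] := sf [::]. Qed.

Lemma smooth_derivable f i x : smooth f -> derivable f x (delta_mx 0 i).
Proof. by move=> sf; have [_] := sf [::]; apply. Qed.

Lemma smooth_partial_continuous f i : smooth f -> continuous (partial i f).
Proof. by move=> sf; have [] := sf [:: i]. Qed.

Lemma smoothM f g : smooth f -> smooth g -> smooth (fun x => f x * g x).
Proof.
by move=> /smooth_uptoP sf /smooth_uptoP sg; apply/smooth_uptoP => k; exact: smooth_uptoM.
Qed.

Lemma smooth_onem f : smooth f -> smooth (fun x => 1 - f x).
Proof.
move=> /smooth_uptoP sf; apply/smooth_uptoP => k.
rewrite (_ : (fun x => _) = fun x => 1 + (- 1) * f x).
  apply: smooth_uptoD; first exact: smooth_upto_cst.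
  by apply: smooth_uptoM; first exact: smooth_upto_cst.
by apply/funext => x; rewrite mulN1r.
Qed.

Lemma bounded_supportM f g : bounded_support g -> bounded_support (fun x => f x * g x).
Proof. by move=> [M gM]; exists M => x /gM ->; rewrite mulr0. Qed.

Lemma continuous_sum (I : Type) (s : seq I) (F : I -> 'rV[R]_n -> R) :
  (forall i, continuous (F i)) -> continuous (fun x => \sum_(i <- s) F i x).
Proof.
move=> cF; elim: s => [|i s IHs].
  rewrite (_ : (fun x => _) = fun=> 0); first by move=> x; exact: cst_continuous.
  by apply/funext => x; rewrite big_nil.
rewrite (_ : (fun x => _) = fun x => F i x + \sum_(i <- s) F i x).
  by move=> x; exact: (cvgD (cF i x) (IHs x)).
by apply/funext => x; rewrite big_cons.
Qed.

Lemma bounded_support_sum (F : 'I_n -> 'rV[R]_n -> R) :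
  (forall i, bounded_support (F i)) -> bounded_support (fun x => \sum_i F i x).
Proof.
move=> /choice[M FM]; exists (\big[Num.max/0]_i M i) => x Mx.
apply: big1 => i _; apply: FM; apply: le_lt_trans Mx.
exact: le_bigmax.
Qed.

Lemma coord_le_enorm (x : 'rV[R]_n) i : `|x 0 i| <= enorm x.
Proof.
rewrite -sqrtr_sqr ler_wsqrtr// /dot (bigD1 i)//= expr2 lerDl.
by apply: sumr_ge0 => j _; rewrite -expr2 sqr_ge0.
Qed.

Lemma enormZ (a : R) (x : 'rV[R]_n) : enorm (a *: x) = `|a| * enorm x.
Proof.
rewrite /enorm (_ : dot _ _ = a ^+ 2 * dot x x).
  by rewrite sqrtrM ?sqr_ge0// sqrtr_sqr.
rewrite /dot mulr_sumr; apply: eq_bigr => i _; rewrite !mxE.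
by ring.
Qed.

Lemma compact_support_bounded xi : compact (Defs.support xi) ->
  exists M, forall x, M < `|x| -> xi x = 0.
Proof.
move=> /compact_bounded [M [_ HM]]; exists (M + 1) => x Mx.
apply/eqP; apply: contraTT Mx => xi0; rewrite -leNgt.
apply: HM; first by rewrite ltrDl.
exact: subset_closure.
Qed.

Lemma test_fields_bounded_support C xi i : test_fields C xi ->
  bounded_support (component xi i).
Proof.
move=> [_ /compact_support_bounded[M xiM] _ _]; exists M => x /xiM.
by rewrite /component => ->; rewrite mxE.
Qed.

Lemma test_fields_divergence C xi : test_fields C xi ->
  continuous (divergence xi) /\ bounded_support (divergence xi).
Proof.
move=> txi; have [sxi _ _ _] := txi; split.
  by apply: continuous_sum => i; exact: smooth_partial_continuous.
apply: bounded_support_sum => i; apply: derive_bounded_support.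
exact: test_fields_bounded_support txi.
Qed.

Lemma test_fields_integrable C xi : test_fields C xi ->
  mu.-integrable setT (fun x => (divergence xi x)%:E).
Proof.
by move=> /test_fields_divergence[? ?]; exact: integrable_bounded_support.
Qed.

Lemma test_fields_scale C xi phi : test_fields C xi -> smooth phi ->
  (forall x, 0 <= phi x <= 1) -> test_fields C (fun x => phi x *: xi x).
Proof.
move=> [sxi cxi subxi xi1] sphi phi01.
have sub : Defs.support (fun x => phi x *: xi x) `<=` Defs.support xi.
  apply: closure_subset => x /=; apply: contraNN => /eqP ->.
  by rewrite scaler0.
split.
- move=> i; rewrite (_ : component _ i = fun x => phi x * component xi i x).
    exact: (smoothM sphi (sxi i)).
  by apply/funext => x; rewrite /component mxE.
- apply: subclosed_compact cxi sub; exact: closed_closure.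
- exact: subset_trans subxi.
- move=> x; have /andP[p0 p1] := phi01 x; rewrite enormZ ger0_norm//.
  by rewrite -[leRHS]mulr1 ler_pM// sqrtr_ge0.
Qed.

Lemma divergence_scale phi xi x : smooth phi ->
  (forall i, smooth (component xi i)) ->
  divergence (fun y => phi y *: xi y) x =
  phi x * divergence xi x + \sum_i partial i phi x * xi x 0 i.
Proof.
move=> sphi sxi; rewrite /divergence mulr_sumr -big_split /=.
apply: eq_bigr => i _.
rewrite (_ : component _ i = phi * component xi i).
  rewrite /partial (deriveM (smooth_derivable sphi) (smooth_derivable (sxi i))).
  by congr (_ + _); exact: mulrC.
by apply/funext => y; rewrite /component mxE.
Qed.

Lemma integral_divergence_eq0 C xi : test_fields C xi ->
  (\int[mu]_x (divergence xi x)%:E = 0)%E.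
Proof.
move=> txi; have [sxi _ _ _] := txi.
under eq_integral do rewrite /divergence -sumEFin.
rewrite integral_sum//.
  rewrite big1// => i _; apply: integral_derive_eq0.
  - exact: smooth_continuous.
  - by move=> x; exact: smooth_derivable.
  - exact: smooth_partial_continuous.
  - exact: test_fields_bounded_support txi.
move=> i; apply: integrable_bounded_support.
  exact: smooth_partial_continuous.
by apply: derive_bounded_support; exact: test_fields_bounded_support txi.
Qed.

Lemma perimeter_ubound C E xi : test_fields C xi ->
  (\int[mu]_(x in E) (divergence xi x)%:E <= perimeter C E)%E.
Proof. by move=> txi; apply: ereal_sup_ubound; exists xi. Qed.

(* Split [xi = (1 - phi) xi + phi xi]: the first summand is tested against [E] and
   the divergence of the second has integral 0 over the whole space. *)
Lemma le_perimeter_cutoff C E xi phi : lebesgue_measurable E ->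
  test_fields C xi -> smooth phi -> (forall x, 0 <= phi x <= 1) ->
  (\int[mu]_(x in E) (divergence xi x)%:E +
     \int[mu]_(x in ~` E) (phi x * divergence xi x)%:E <=
   perimeter C E + \int[mu]_x (\sum_i `|partial i phi x|)%:E)%E.
Proof.
move=> mE txi sphi phi01; have [sxi _ _ xi1] := txi.
pose eta x := (1 - phi x) *: xi x; pose zeta x := phi x *: xi x.
have teta : test_fields C eta.
  apply: (test_fields_scale (phi := fun x => 1 - phi x) txi (smooth_onem sphi)).
  by move=> x; have /andP[p0 p1] := phi01 x; apply/andP; split; lra.
have tzeta : test_fields C zeta by exact: test_fields_scale.
(* The part of the divergence of [zeta] in which the derivative falls on [phi]. *)
pose g x := \sum_i partial i phi x * xi x 0 i.
have cg : continuous g.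
  apply: continuous_sum => i x; apply: continuousM.
    exact: smooth_partial_continuous.
  exact: (smooth_continuous (sxi i)).
have bg : bounded_support g.
  apply: bounded_support_sum => i; apply: bounded_supportM.
  exact: test_fields_bounded_support txi.
have ig := integrable_bounded_support cg bg.
have zetaE x : divergence zeta x = phi x * divergence xi x + g x.
  exact: divergence_scale.
have etaE x : divergence eta x = divergence xi x - divergence zeta x.
  rewrite /divergence -sumrB; apply: eq_bigr => i _.
  rewrite (_ : component eta i = component xi i - component zeta i).
    have [szeta _ _ _] := tzeta.
    exact: (deriveB (smooth_derivable (sxi i)) (smooth_derivable (szeta i))).
  by apply/funext => y; rewrite /component !mxE /= !fctE !mxE mulrBl mul1r.
have := le_integral_cutoff mE (test_fields_integrable teta)
  (test_fields_integrable tzeta) ig (integral_divergence_eq0 tzeta).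
have -> : (\int[mu]_(x in E) (divergence eta x + divergence zeta x)%:E =
    \int[mu]_(x in E) (divergence xi x)%:E)%E.
  by apply: eq_integral => x _; rewrite etaE subrK.
have -> : (\int[mu]_(x in ~` E) (divergence zeta x - g x)%:E =
    \int[mu]_(x in ~` E) (phi x * divergence xi x)%:E)%E.
  by apply: eq_integral => x _; rewrite zetaE addrK.
move=> /le_trans; apply; apply: leeD; first exact: perimeter_ubound.
apply: ge0_le_integral.
- exact: measurableT.
- by move=> x _; rewrite lee_fin.
- apply/measurable_EFinP; apply: continuous_measurable_cara => x.
  by apply: (continuous_comp (cg x)); exact: norm_continuous.
- apply/measurable_EFinP; apply: continuous_measurable_cara.
  apply: continuous_sum => i x; apply: continuous_comp; last exact: norm_continuous.
  exact: smooth_partial_continuous.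
(* Coordinates of [xi] are at most 1 in absolute value. The sum of the |partial i phi|, unlike the
   Euclidean norm of the gradient, can be estimated one partial derivative at a time. *)
- move=> x _; rewrite lee_fin (le_trans (ler_norm_sum _ _ _))//.
  apply: ler_sum => i _; rewrite normrM -[leRHS]mulr1 ler_wpM2l//.
  by rewrite (le_trans (coord_le_enorm _ _)).
Qed.

End test_fields.

(** The union is E together with the part of Q outside E, and the integrals over the complement
    converge with |f| as majorant. *)
Lemma le_integral_setU_lim d (T : measurableType d) (R : realType)
    (m : {measure set T -> \bar R}) (E Q : set T) (f : T -> R)
    (phi : nat -> T -> R) (M : \bar R) :
  measurable E -> measurable Q -> m.-integrable setT (EFin \o f) ->
  (forall k, measurable_fun setT (phi k)) -> (forall k x, `|phi k x| <= 1) ->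
  (forall x, phi k x @[k --> \oo] --> (\1_Q x : R)) ->
  (forall k, \int[m]_(x in E) (f x)%:E + \int[m]_(x in ~` E) (phi k x * f x)%:E <= M)%E ->
  (\int[m]_(x in E `|` Q) (f x)%:E <= M)%E.
Proof.
move=> mE mQ intf mphi phi1 phiQ leM.
have mEC : measurable (~` E) by exact: measurableC.
have mf : measurable_fun setT f.
  by apply/measurable_EFinP; exact: (measurable_int _ intf).
have -> : (\int[m]_(x in E `|` Q) (f x)%:E = \int[m]_(x in E) (f x)%:E +
    \int[m]_(x in ~` E) (\1_Q x * f x)%:E)%E.
  have -> : E `|` Q = E `|` (~` E `&` Q).
    by rewrite setUIr setUv setTI.
  rewrite integral_setU//; last 3 first.
  - exact: measurableI.
  - by apply/measurable_EFinP; exact: measurable_funTS.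
  - by apply/disj_setPS; rewrite setIA setICr set0I.
  congr (_ + _)%E; rewrite integral_mkcondr.
  apply: eq_integral => x _; rewrite patchE indicE.
  by case: (x \in Q); rewrite ?mul1r ?mul0r.
have [|||||_ _ cvgI] := @dominated_convergence _ _ _ m _ mEC
  (fun k x => (phi k x * f x)%:E) (fun x => (\1_Q x * f x)%:E) (fun x => `|(f x)%:E|%E).
- by move=> k; apply/measurable_EFinP; apply: measurable_funTS; apply: measurable_funM.
- by apply/measurable_EFinP; apply: measurable_funTS; apply: measurable_funM.
- apply: aeW => x _; apply: cvg_EFin; first exact: nearW.
  by apply: cvgMr_tmp; exact: phiQ.
- by apply: integrable_abse; apply: integrableS intf.
- apply: aeW => x k _; rewrite !abse_EFin lee_fin normrM.
  by rewrite -[leRHS]mul1r ler_wpM2r.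
have fE : (\int[m]_(x in E) (f x)%:E)%E \is a fin_num.
  by apply: integrable_fin_num => //; exact: integrableS intf.
have cvgS : (\int[m]_(x in E) (f x)%:E + \int[m]_(x in ~` E) (phi k x * f x)%:E
    @[k --> \oo] --> \int[m]_(x in E) (f x)%:E + \int[m]_(x in ~` E) (\1_Q x * f x)%:E)%E.
  apply: cvgeD => //; first exact: fin_num_adde_defr.
  exact: cvg_cst.
by apply: (cvge_to_le cvgS); apply: nearW => k; exact: leM.
Qed.

(** Here [c] stands for the perimeter of Q: it bounds the total variation of smooth approximations
    of the indicator of Q. *)
Lemma perimeter_setU_le (R : realType) n (C E Q : set 'rV[R]_n)
    (phi : nat -> 'rV[R]_n -> R) (c : \bar R) :
  lebesgue_measurable E -> lebesgue_measurable Q ->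
  (forall k, smooth (phi k)) -> (forall k x, 0 <= phi k x <= 1) ->
  (forall x, phi k x @[k --> \oo] --> (\1_Q x : R)) ->
  (forall k, \int[lebesgue_rV R n]_x (\sum_i `|partial i (phi k) x|)%:E <= c)%E ->
  (perimeter C (E `|` Q) <= perimeter C E + c)%E.
Proof.
move=> mE mQ sphi phi01 phiQ phic; apply: ge_ereal_sup => _ [xi txi <-].
have mphi k : measurable_fun setT (phi k : cara R n -> R).
  by apply: continuous_measurable_cara; exact: smooth_continuous (sphi k).
have phi1 k x : `|phi k x| <= 1.
  by have /andP[p0 p1] := phi01 k x; rewrite ger0_norm.
apply: (le_integral_setU_lim mE mQ (test_fields_integrable txi) mphi phi1 phiQ) => k.
apply: le_trans (le_perimeter_cutoff mE txi (sphi k) (phi01 k)) _.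
exact: leeD2l.
Qed.

(** * Smooth cutoffs of an interval *)

Section cutoff.
Context {R : realType}.
Variables (p r : R).
Implicit Types (t : R) (k : nat).

(* The exponent is odd so that [atan (cutoff_arg k t)] is nondecreasing in [t]: its
   derivative dominates that of [cutoff k] and has integral at most pi.  The factor
   [k.+1] sends [cutoff k t] to 0 also when [`|t - p| = r]. *)
Definition cutoff_arg k t : R := k.+1%:R * ((t - p) / r) ^+ (k.*2.+1).

Definition cutoff_arg_deriv k t : R :=
  k.+1%:R * k.*2.+1%:R * ((t - p) / r) ^+ k.*2 / r.

(** Rational rather than compactly supported: the test field that it multiplies has compact support
    already. *)
Definition cutoff k t : R := (1 + cutoff_arg k t ^+ 2)^-1.

Definition cutoff_deriv k t : R :=
  - (2 * cutoff_arg k t * cutoff_arg_deriv k t) / (1 + cutoff_arg k t ^+ 2) ^+ 2.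

Lemma oneDsqr_gt0 t : 0 < 1 + t ^+ 2.
Proof. by rewrite ltr_wpDr// sqr_ge0. Qed.

Lemma is_derive_cutoff_arg k t :
  is_derive t (1 : R) (cutoff_arg k) (cutoff_arg_deriv k t).
Proof.
have D : is_derive t (1 : R) (fun s : R => (s - p) / r) r^-1.
  rewrite (_ : (fun s => _) = r^-1 *: (id - cst p)).
    by apply: is_derive_eq; rewrite subr0 /GRing.scale /= mulr1.
  by apply/funext => s; rewrite mulrC.
rewrite (_ : cutoff_arg k =
    k.+1%:R *: ((fun s : R => (s - p) / r) ^+ k.*2.+1)); last first.
  by apply/funext => s; rewrite /= exprfctE.
apply: is_derive_eq.
by rewrite /cutoff_arg_deriv /GRing.scale /=; ring.
Qed.

Lemma is_derive_inv1Dsqr (w : R -> R) (t dw : R) : is_derive t (1 : R) w dw ->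
  is_derive t (1 : R) (fun s => (1 + w s ^+ 2)^-1)
    (- (2 * w t * dw) / (1 + w t ^+ 2) ^+ 2).
Proof.
move=> Dw.
have h0 : 1 + w t ^+ 2 != 0 by rewrite gt_eqF// oneDsqr_gt0.
have D : is_derive t (1 : R) (fun s => 1 + w s ^+ 2) (2 * w t * dw).
  have D2 : is_derive t (1 : R) (w * w) (2 * w t * dw).
    apply: (is_derive_eq (is_deriveM Dw Dw)).
    by rewrite /GRing.scale /= -mulrA mulr_natl mulr2n.
  have D1 : is_derive t (1 : R) (cst (1 : R)) 0 by exact: is_derive_cst.
  rewrite (_ : (fun s => _) = cst 1 + w * w).
    by apply: (is_derive_eq (is_deriveD D1 D2)); rewrite add0r.
  by apply/funext => s; rewrite expr2.
apply: (is_derive_eq (@is_deriveV R (fun s => 1 + w s ^+ 2) t _ 1 h0 D)).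
by rewrite /GRing.scale /= mulNr mulrC mulNr.
Qed.

Lemma is_derive_cutoff k t : is_derive t (1 : R) (cutoff k) (cutoff_deriv k t).
Proof. exact: (is_derive_inv1Dsqr (is_derive_cutoff_arg k t)). Qed.

Lemma is_derive_atan_cutoff_arg k t :
  is_derive t (1 : R) (fun s => atan (cutoff_arg k s))
    (cutoff_arg_deriv k t / (1 + cutoff_arg k t ^+ 2)).
Proof.
have Dw := is_derive_cutoff_arg k t.
have := is_derive1_comp (is_derive1_atan (cutoff_arg k t)) Dw.
move=> H; apply: (is_derive_eq H); by rewrite mulrC.
Qed.

(** Provides a bounded primitive of [cutoff_bound]. *)
Lemma is_derive_atan_affine t : r != 0 ->
  is_derive t (1 : R) (fun s => (2 * r) * atan ((s - p) / r))
    (2 / (1 + ((t - p) / r) ^+ 2)).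
Proof.
move=> r0.
have D : is_derive t (1 : R) (fun s : R => (s - p) / r) r^-1.
  rewrite (_ : (fun s => _) = r^-1 *: (id - cst p)).
    by apply: is_derive_eq; rewrite subr0 /GRing.scale /= mulr1.
  by apply/funext => s; rewrite mulrC.
have H := @is_derive1_comp R atan (fun s => (s - p) / r) t _ _
  (is_derive1_atan ((t - p) / r)) D.
rewrite (_ : (fun s => _) = (2 * r) *: (atan \o (fun s : R => (s - p) / r)))//.
apply: (is_derive_eq (is_deriveZ (2 * r) H)); rewrite /GRing.scale /=.
have h0 := lt0r_neq0 (oneDsqr_gt0 ((t - p) / r)).
set z := 1 + _ in h0 *; by field; rewrite r0 h0.
Qed.
End cutoff.

Section cutoff_bounds.
Context {R : realType}.
Variables (p r : R).
Hypothesis r_gt0 : 0 < r.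
Implicit Types (t : R) (k : nat).

Lemma continuous_affineX (m : nat) : continuous (fun t : R => ((t - p) / r) ^+ m).
Proof.
move=> t; apply: (@continuous_comp _ _ _ (fun t : R => (t - p) / r) (fun s => s ^+ m)).
  by apply: cvgMr_tmp; apply: cvgB; [exact: cvg_id|exact: cvg_cst].
exact: exprn_continuous.
Qed.

Lemma continuous_cutoff_arg k : continuous (cutoff_arg p r k).
Proof. by move=> t; apply: cvgMl_tmp; exact: continuous_affineX. Qed.

Lemma continuous_cutoff_arg_deriv k : continuous (cutoff_arg_deriv p r k).
Proof. by move=> t; apply: cvgMr_tmp; apply: cvgMl_tmp; exact: continuous_affineX. Qed.

Lemma cutoff_arg_deriv_ge0 k t : 0 <= cutoff_arg_deriv p r k t.
Proof.
rewrite /cutoff_arg_deriv -muln2 mulnC exprM.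
by rewrite !mulr_ge0 ?invr_ge0 ?(ltW r_gt0)// exprn_ge0// sqr_ge0.
Qed.

(** The derivative of [atan (cutoff_arg p r k t)], so its integral is at most pi for every k and
    r. *)
Definition cutoff_deriv_bound k t : R :=
  cutoff_arg_deriv p r k t / (1 + cutoff_arg p r k t ^+ 2).

(** A majorant of [cutoff p r k] common to all k, with integral of order r. The numerator 2 makes it
    at least 1 where |t - p| <= r. *)
Definition cutoff_bound t : R := 2 / (1 + ((t - p) / r) ^+ 2).

Lemma cutoff_deriv_bound_ge0 k t : 0 <= cutoff_deriv_bound k t.
Proof. by rewrite divr_ge0 ?cutoff_arg_deriv_ge0// ltW// oneDsqr_gt0. Qed.

Lemma cutoff_bound_ge0 t : 0 <= cutoff_bound t.
Proof. by rewrite divr_ge0// ltW// oneDsqr_gt0. Qed.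

Lemma continuous_inv1Dsqr (w : R -> R) : continuous w ->
  continuous (fun t => (1 + w t ^+ 2)^-1).
Proof.
move=> cw t; apply: cvgV; first by rewrite gt_eqF// oneDsqr_gt0.
apply: cvgD; first exact: cvg_cst.
apply: (@continuous_comp _ _ _ w (fun s => s ^+ 2)); first exact: cw.
exact: exprn_continuous.
Qed.

Lemma continuous_cutoff_deriv_bound k : continuous (cutoff_deriv_bound k).
Proof.
have c1 := continuous_inv1Dsqr (continuous_cutoff_arg (k := k)).
by move=> t; exact: (cvgM (continuous_cutoff_arg_deriv (k := k) (x := t)) (c1 t)).
Qed.

Lemma continuous_cutoff_bound : continuous cutoff_bound.
Proof.
have c1 : continuous (fun t : R => (t - p) / r).
  by move=> t; apply: cvgMr_tmp; apply: cvgB; [exact: cvg_id|exact: cvg_cst].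
by move=> t; apply: cvgMl_tmp; exact: (continuous_inv1Dsqr c1).
Qed.

(** With w the value of [cutoff_arg], the quotient of the two sides is 2 |w| / (1 + w ^ 2), at most
    1 because (|w| - 1) ^ 2 >= 0. *)
Lemma norm_cutoff_deriv_le k t : `|cutoff_deriv p r k t| <= cutoff_deriv_bound k t.
Proof.
rewrite /cutoff_deriv /cutoff_deriv_bound; set w := cutoff_arg _ _ _ _.
have w0 := oneDsqr_gt0 w; have d0 := cutoff_arg_deriv_ge0 k t.
rewrite normrM normrN normfV (ger0_norm (sqr_ge0 _)) ler_pdivrMr ?exprn_gt0//.
rewrite (_ : _ / _ * _ = cutoff_arg_deriv p r k t * (1 + w ^+ 2)); last first.
  by rewrite [X in _ * X]expr2 mulrA divfK// gt_eqF.
rewrite normrM (ger0_norm d0) mulrC.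
rewrite ler_wpM2l// normrM ger0_norm// -(real_normK (num_real w)).
by have := sqr_ge0 (`|w| - 1); rewrite sqrrB1; lra.
Qed.

Lemma cutoff_ge0 k t : 0 <= cutoff p r k t.
Proof. by rewrite invr_ge0 ltW// oneDsqr_gt0. Qed.

Lemma cutoff_le1 k t : cutoff p r k t <= 1.
Proof. by rewrite invf_le1 ?oneDsqr_gt0// lerDl sqr_ge0. Qed.

Lemma norm_cutoff_arg_ge k t : 1 <= `|(t - p) / r| ->
  k.+1%:R * `|(t - p) / r| <= `|cutoff_arg p r k t|.
Proof.
rewrite /cutoff_arg; move: (_ / r) => y y1.
rewrite normrM normr_nat ler_wpM2l// normrX exprS.
by rewrite ler_peMr// exprn_ege1.
Qed.

(** Put y = (t - p) / r. If |y| < 1 the right side is at least 1; otherwise |[cutoff_arg]| >= |y|,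
    and even 1 / (1 + y ^ 2) is an upper bound. *)
Lemma cutoff_le_bound k t : cutoff p r k t <= cutoff_bound t.
Proof.
rewrite /cutoff /cutoff_bound.
have [y1|y1] := leP 1 `|(t - p) / r|; last first.
  apply: le_trans (cutoff_le1 k t) _.
  rewrite ler_pdivlMr ?oneDsqr_gt0// mul1r -(real_normK (num_real _)).
  by have : `|(t - p) / r| ^+ 2 <= 1; [rewrite expr_le1// ltW|lra].
have h : ((t - p) / r) ^+ 2 <= cutoff_arg p r k t ^+ 2.
  rewrite -[leLHS](real_normK (num_real _)) -[leRHS](real_normK (num_real _)).
  rewrite lerXn2r ?nnegrE//; apply: le_trans (norm_cutoff_arg_ge k y1).
  by rewrite ler_peMl// ler1n.
rewrite ler_pdivlMr ?oneDsqr_gt0// mulrC ler_pdivrMr ?oneDsqr_gt0//.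
by have := sqr_ge0 ((t - p) / r); lra.
Qed.

(** Each of the k + 1 terms of 1 + q + ... + q ^ k is at least q ^ k, and the sum is at most 1 / (1
    - q). *)
Lemma natr_expr_le (q : R) k : 0 <= q -> q < 1 -> k.+1%:R * q ^+ k <= (1 - q)^-1.
Proof.
move=> q0 q1; have q10 : 0 < 1 - q by rewrite subr_gt0.
rewrite -[leRHS]mul1r ler_pdivlMr//.
suff : k.+1%:R * q ^+ k * (1 - q) <= 1 - q ^+ k.+1.
  by move/le_trans; apply; rewrite gerBl exprn_ge0.
elim: k => [|k IHk]; first by rewrite mul1r expr0 mul1r expr1.
have qk : q ^+ k.+1 <= 1 by rewrite expr_le1// ltW.
have e : k.+2%:R * q ^+ k.+1 * (1 - q) =
    q * (k.+1%:R * q ^+ k * (1 - q)) + q ^+ k.+1 * (1 - q).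
  by rewrite -[in LHS]natr1 exprS; ring.
have h1 := ler_wpM2l q0 IHk.
have h2 : q ^+ k.+1 * (1 - q) <= 1 - q by rewrite ler_piMl// ltW.
rewrite e (le_trans (lerD h1 h2))// [q ^+ k.+2]exprS; lra.
Qed.

(** Convergence holds at every point, endpoints included, and the limit is the indicator of the open
    interval, in accordance with [cube]. *)
Lemma cvg_cutoff t : cutoff p r k t @[k --> \oo] --> ((`|t - p| < r)%R%:R : R).
Proof.
have yE : `|(t - p) / r| = `|t - p| / r by rewrite normrM normfV (gtr0_norm r_gt0).
have [tr|rt] := ltP `|t - p| r; last first.
  have y1 : 1 <= `|(t - p) / r| by rewrite yE ler_pdivlMr// mul1r.
  apply: (@squeeze_cvgr _ _ _ _ (fun=> 0) (fun k => k.+1%:R^-1)); last 2 first.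
  - exact: cvg_cst.
  - exact: cvg_harmonic.
  apply: nearW => k; rewrite cutoff_ge0 /cutoff lef_pV2 ?posrE ?oneDsqr_gt0//.
  have h : k.+1%:R <= `|cutoff_arg p r k t|.
    by apply: le_trans (norm_cutoff_arg_ge k y1); rewrite ler_peMr.
  rewrite -(real_normK (num_real (cutoff_arg _ _ _ _))).
  have k1 : 1 <= k.+1%:R :> R by rewrite ler1n.
  by nra.
set q := `|(t - p) / r|.
have q0 : 0 <= q by exact: normr_ge0.
have q1 : q < 1 by rewrite /q yE ltr_pdivrMr// mul1r.
have C : cutoff_arg p r k t @[k --> \oo] --> (0 : R).
  apply/norm_cvg0P.
  apply: (@squeeze_cvgr _ _ _ _ (fun=> 0) (fun k => (1 - q)^-1 * q ^+ k)); last 2 first.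
  - exact: cvg_cst.
  - rewrite -(mulr0 (1 - q)^-1); apply: cvgMl_tmp; apply: cvg_expr.
    by rewrite ger0_norm.
  apply: nearW => k; rewrite normr_ge0 /cutoff_arg [leLHS]normrM normrX normr_nat.
  (* The exponent 2 k + 1 is split as k + (k + 1): the first power absorbs the factor k + 1, the
     second tends to 0. *)
  rewrite -/q -addnn -addnS exprD mulrA.
  apply: ler_pM => //; rewrite ?mulr_ge0 ?exprn_ge0//; first exact: natr_expr_le.
  by rewrite exprS ler_piMl// ?exprn_ge0// ltW.
have C2 : cutoff_arg p r k t * cutoff_arg p r k t @[k --> \oo] --> (0 * 0 : R).
  by apply: (cvgM C).
rewrite mulr0 in C2.
have C3 : 1 + cutoff_arg p r k t * cutoff_arg p r k t @[k --> \oo] --> (1 + 0 : R).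
  by apply: cvgD => //; exact: cvg_cst.
rewrite addr0 in C3.
rewrite (_ : (fun k => _) =
    fun k => (1 + cutoff_arg p r k t * cutoff_arg p r k t)^-1); last first.
  by apply/funext => k; rewrite /cutoff expr2.
rewrite [X in _ --> X](_ : _ = 1^-1); last by rewrite invr1.
by apply: cvgV => //; exact: oner_neq0.
Qed.

Lemma integral_cutoff_deriv_bound k :
  (\int[lebesgue_measure]_t (cutoff_deriv_bound k t)%:E <= (pi : R)%:E)%E.
Proof.
have -> : (pi : R) = pi / 2 - - (pi / 2) by rewrite opprK -splitr.
apply: (integral_derive_monotone_le (is_derive_atan_cutoff_arg p r k)).
- exact: continuous_cutoff_deriv_bound.
- exact: cutoff_deriv_bound_ge0.
- by move=> t; rewrite !ltW// ?atan_gtNpi2 ?atan_ltpi2.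
Qed.

Lemma integral_cutoff_bound :
  (\int[lebesgue_measure]_t (cutoff_bound t)%:E <= (2 * pi * r)%:E)%E.
Proof.
have r0 : r != 0 by rewrite gt_eqF.
have -> : 2 * pi * r = 2 * r * (pi / 2) - 2 * r * - (pi / 2) by field.
apply: (integral_derive_monotone_le (fun t => is_derive_atan_affine p t r0)).
- exact: continuous_cutoff_bound.
- exact: cutoff_bound_ge0.
- by move=> t; rewrite !ler_pM2l ?mulr_gt0// !ltW// ?atan_gtNpi2 ?atan_ltpi2.
Qed.

End cutoff_bounds.

(** * Smooth cutoffs of a cube *)

Lemma derive_prod_coord (R : realType) n (g : 'I_n -> R -> R) (dg : R) (i : 'I_n)
    (x : 'rV[R]_n) : is_derive (x 0 i) (1 : R) (g i) dg ->
  'D_(delta_mx 0 i) (fun y : 'rV[R]_n => \prod_j g j (y 0 j)) x =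
  dg * \prod_(j | j != i) g j (x 0 j).
Proof.
move=> [dgi dgE].
pose rest := \prod_(j | j != i) g j (x 0 j).
rewrite /derive (_ : (fun h : R => _) = (fun h : R =>
    (h^-1 *: ((g i \o shift (x 0 i)) (h *: (1 : R)) - g i (x 0 i))) * rest)); last first.
  apply/funext => h; rewrite /= (bigD1 i)//= [X in _ - X](bigD1 i)//=.
  rewrite (eq_bigr (fun j => g j (x 0 j))); last first.
    by move=> j ji; rewrite !mxE eqxx (negbTE ji) mulr0 add0r.
  rewrite -/rest !mxE !eqxx /GRing.scale /= mulr1.
  by ring.
apply: cvg_lim => //; apply: cvgMr_tmp.
by rewrite -dgE; exact: dgi.
Qed.

Section cube_cutoff.
Context {R : realType} {n : nat}.
Variables (p : 'rV[R]_n) (r : R).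
Hypothesis r_gt0 : 0 < r.
Implicit Types x : 'rV[R]_n.

Definition cube_cutoff k x : R := \prod_i cutoff (p 0 i) r k (x 0 i).

Lemma smooth_cube_cutoff k : smooth (cube_cutoff k).
Proof.
apply/smooth_uptoP => m.
apply: (@smooth_upto_prod _ _ _ _ _ (fun i x => cutoff (p 0 i) r k (x 0 i))) => i.
apply: (@smooth_uptoV _ _ _ (fun x => 1 + cutoff_arg (p 0 i) r k (x 0 i) ^+ 2)).
  by move=> x; rewrite gt_eqF// oneDsqr_gt0.
apply: smooth_uptoD; first exact: smooth_upto_cst.
apply: (@smooth_upto_exp _ _ _ _ (fun x => cutoff_arg (p 0 i) r k (x 0 i))).
apply: smooth_uptoM; first exact: smooth_upto_cst.
apply: (@smooth_upto_exp _ _ _ _ (fun x => (x 0 i - p 0 i) / r)).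
apply: smooth_uptoM; last exact: smooth_upto_cst.
by apply: smooth_uptoD; [exact: smooth_upto_coord|exact: smooth_upto_cst].
Qed.

Lemma cube_cutoff_itv k x : 0 <= cube_cutoff k x <= 1.
Proof.
rewrite prodr_ge0; last by move=> i _; exact: cutoff_ge0.
by apply: prodr_ile1 => i; rewrite cutoff_ge0 cutoff_le1.
Qed.

Lemma cvg_cube_cutoff x : cube_cutoff k x @[k --> \oo] --> (\1_(cube p r) x : R).
Proof.
have -> : \1_(cube p r) x = \prod_i (`|x 0 i - p 0 i| < r)%R%:R :> R.
  rewrite indicE; have [xQ|xQ] := pselect (cube p r x).
    by rewrite mem_set// big1// => i _; rewrite xQ.
  rewrite memNset//; apply/esym/eqP; rewrite prodf_seq_eq0.
  apply: contra_notT xQ => /hasPn xQ i; have := xQ i (mem_index_enum i).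
  by rewrite /=; case: (_ < r) => //; rewrite eqxx.
apply: cvg_big => [|i _]; last exact: cvg_cutoff.
by move=> [a b]; apply: cvgM; [exact: cvg_fst|exact: cvg_snd].
Qed.

(** Factor j of a majorant of |partial i (cube_cutoff k)|. The majorant is a product of functions of
    one coordinate each, so Tonelli integrates it factor by factor. *)
Definition cube_cutoff_bound k (i : 'I_n) (j : 'I_n) (t : R) : R :=
  if j == i then cutoff_deriv_bound (p 0 j) r k t else cutoff_bound (p 0 j) r t.

Lemma cube_cutoff_bound_ge0 k i j t : 0 <= cube_cutoff_bound k i j t.
Proof.
by rewrite /cube_cutoff_bound; case: ifP => _;
  [exact: cutoff_deriv_bound_ge0|exact: cutoff_bound_ge0].
Qed.

Lemma continuous_cube_cutoff_bound k i j : continuous (cube_cutoff_bound k i j).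
Proof.
rewrite /cube_cutoff_bound; case: (j == i).
  exact: continuous_cutoff_deriv_bound.
exact: continuous_cutoff_bound.
Qed.

Lemma norm_partial_cube_cutoff_le k i x :
  `|partial i (cube_cutoff k) x| <= \prod_j cube_cutoff_bound k i j (x 0 j).
Proof.
rewrite /partial (@derive_prod_coord R n (fun j => cutoff (p 0 j) r k) _ i x
  (is_derive_cutoff (p 0 i) r k (x 0 i))).
rewrite [leRHS](bigD1 i)//= normrM; apply: ler_pM; rewrite ?normr_ge0//.
  by rewrite /cube_cutoff_bound eqxx; exact: norm_cutoff_deriv_le.
rewrite normr_prod; apply: ler_prod => j ji.
rewrite normr_ge0 /cube_cutoff_bound (negbTE ji) ger0_norm ?cutoff_ge0//.
exact: cutoff_le_bound.
Qed.

(** The differentiated factor costs pi, independently of r and k; each of the [n.-1] others costs 2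
    pi r. Hence the order of a surface area. *)
Lemma integral_cube_cutoff_bound k i :
  (\int[lebesgue_rV R n]_x (\prod_j cube_cutoff_bound k i j (x 0 j))%:E <=
   (pi * (2 * pi * r) ^+ n.-1)%:E)%E.
Proof.
have b0 := cube_cutoff_bound_ge0 k i.
have mb j : measurable_fun setT (cube_cutoff_bound k i j).
  by apply: continuous_measurable_fun => t; exact: continuous_cube_cutoff_bound.
pose c j : R := if j == i then pi else 2 * pi * r.
have Ic j : (\int[lebesgue_measure]_t (cube_cutoff_bound k i j t)%:E <= (c j)%:E)%E.
  rewrite /cube_cutoff_bound /c; case: ifP => _.
    exact: integral_cutoff_deriv_bound.
  exact: integral_cutoff_bound.
have I0 j : (0 <= \int[lebesgue_measure]_t (cube_cutoff_bound k i j t)%:E)%E.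
  by apply: integral_ge0 => t _; rewrite lee_fin.
have If j : (\int[lebesgue_measure]_t (cube_cutoff_bound k i j t)%:E)%E \is a fin_num.
  by rewrite ge0_fin_numE// (le_lt_trans (Ic j))// ltry.
rewrite (@integral_prod_rV R n _
  (fun j => fine (\int[lebesgue_measure]_t (cube_cutoff_bound k i j t)%:E)%E)
  mb b0); last first.
  by move=> j; rewrite fineK.
rewrite lee_fin (_ : pi * _ = \prod_j c j); last first.
  rewrite (bigD1 i)//=; congr (_ * _); first by rewrite /c eqxx.
  rewrite (eq_bigr (fun=> 2 * pi * r)); last by move=> j ji; rewrite /c (negbTE ji).
  by rewrite prodr_const cardC1 card_ord.
apply: ler_prod => j _; rewrite fine_ge0//=.
by rewrite -lee_fin fineK.
Qed.

End cube_cutoff.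

(** One term for each of the n partial derivatives. The constant is not sharp; what matters is the
    power of r and the independence from E and p. *)
Lemma perimeter_setU_cube (R : realType) n (C E : set 'rV[R]_n) (p : 'rV[R]_n) (r : R) :
  0 < r -> lebesgue_measurable E ->
  (perimeter C (E `|` cube p r) <=
   perimeter C E + (n%:R * (pi * (2 * pi * r) ^+ n.-1))%:E)%E.
Proof.
move=> r0 mE.
apply: (@perimeter_setU_le _ _ _ _ _ (cube_cutoff p r)) => //.
- by apply: measurable_lebesgue; exact: measurable_cube.
- by move=> k; exact: smooth_cube_cutoff.
- by move=> k x; exact: cube_cutoff_itv.
- by move=> x; exact: cvg_cube_cutoff.
move=> k.
pose B i (x : 'rV[R]_n) := \prod_j cube_cutoff_bound p r k i j (x 0 j).
have B0 i x : 0 <= B i x.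
  by apply: prodr_ge0 => j _; exact: cube_cutoff_bound_ge0.
have mB i : measurable_fun setT ((fun x => (B i x)%:E) : cara R n -> \bar R).
  apply/measurable_EFinP; apply: measurable_prod => j _.
  apply: continuous_measurable_cara => x.
  apply: (@continuous_comp _ _ _ (fun x : 'rV[R]_n => x 0 j)).
    exact: coord_continuous.
  exact: continuous_cube_cutoff_bound.
apply: (@le_trans _ _ (\int[lebesgue_rV R n]_x (\sum_i (B i x)%:E))%E).
  apply: ge0_le_integral.
  - exact: measurableT.
  - by move=> x _; rewrite lee_fin; apply: sumr_ge0 => i _; exact: normr_ge0.
  - apply/measurable_EFinP; apply: continuous_measurable_cara.
    apply: continuous_sum => i x; apply: continuous_comp; last exact: norm_continuous.
    by apply: smooth_partial_continuous; exact: smooth_cube_cutoff.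
  - exact: emeasurable_sum.
  - move=> x _; rewrite sumEFin lee_fin; apply: ler_sum => i _.
    exact: norm_partial_cube_cutoff_le.
rewrite ge0_integral_sum; [|exact: measurableT|exact: mB|
  by move=> i x _; rewrite lee_fin; exact: B0].
rewrite [leRHS](_ : _ = \sum_(i < n) (pi * (2 * pi * r) ^+ n.-1)%:E)%E.
  by apply: lee_sum => i _; exact: integral_cube_cutoff_bound.
by rewrite sumEFin sumr_const card_ord mulr_natl.
Qed.

(** * Recession direction of a cylindrically bounded body *)

Lemma convex_setP (R : realType) n (C : set 'rV[R]_n) (x y : 'rV[R]_n) (t : R) :
  convex_set C -> C x -> C y -> 0 <= t -> t <= 1 -> C (t *: x + (1 - t) *: y).
Proof.
move=> cC Cx Cy t0 t1.
by have := cC x y (Itv01 t0 t1) (mem_set Cx) (mem_set Cy); rewrite inE.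
Qed.

Lemma bounded_set_le (R : realType) n (A : set 'rV[R]_n) :
  bounded_set A <-> exists M, forall x, A x -> `|x| <= M.
Proof.
split=> [[M [_ HM]]|[M HM]].
  by exists (M + 1) => x Ax; apply: HM Ax; rewrite ltrDl.
exists M; split; first exact: num_real.
by move=> N MN x /= /HM xM; rewrite (le_trans xM)// ltW.
Qed.

Lemma closed_approx (R : realType) n (C : set 'rV[R]_n) (x : 'rV[R]_n) :
  closed C -> (forall e, 0 < e -> exists2 y, C y & `|x - y| < e) -> C x.
Proof.
move=> /closure_id clC approx; rewrite clC => B /nbhs_ballP[e /= e0 eB].
have [y Cy xy] := approx e e0; exists y; split => //.
by apply: eB; rewrite -ball_normE.
Qed.

(** Take y in C far away in the direction [v]. The point of the segment from x to y with weight t /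
    s y on y is close to x + t v, because [pr y] stays bounded. *)
Lemma recession_unbounded (R : realType) n (C : set 'rV[R]_n) (v : 'rV[R]_n)
    (pr : 'rV[R]_n -> 'rV[R]_n) (s : 'rV[R]_n -> R) (M : R) :
  closed C -> convex_set C ->
  (forall x, C x -> `|pr x| <= M) -> (forall x, x = pr x + s x *: v) ->
  (forall K, exists2 x, C x & K < s x) ->
  forall x t, 0 <= t -> C x -> C (x + t *: v).
Proof.
move=> clC cvC prM decE unb x t t0 Cx; apply: closed_approx => // e e0.
have Mx0 : 0 <= M + `|x| by rewrite addr_ge0// (le_trans _ (prM x Cx)).
(* The first term makes the weight t / s y at most 1; the second makes the error (t / s y) |x - pr
   y| smaller than [e]. *)
have [y Cy sy] := unb (t + t * (M + `|x|) / e).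
have tMe : 0 <= t * (M + `|x|) / e by rewrite divr_ge0 ?mulr_ge0// ltW.
have ty : t < s y by lra.
have sy0 : 0 < s y by lra.
exists (t / s y *: y + (1 - t / s y) *: x).
  apply: convex_setP => //; first by rewrite divr_ge0// ltW.
  by rewrite ler_pdivrMr// mul1r ltW.
rewrite [X in t / s y *: X](decE y).
rewrite (_ : _ - _ = (t / s y) *: (x - pr y)); last first.
  rewrite scalerDr scalerA divfK ?gt_eqF// scalerBl scale1r scalerBr.
  by apply/rowP => i; rewrite !mxE; ring.
rewrite normrZ ger0_norm; last by rewrite divr_ge0// ltW.
apply: (@le_lt_trans _ _ (t / s y * (M + `|x|))).
  rewrite ler_wpM2l//; first by rewrite divr_ge0// ltW.
  by rewrite (le_trans (ler_normB _ _))// addrC lerD2r prM.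
rewrite mulrAC ltr_pdivrMr// [e * _]mulrC -ltr_pdivrMr//.
lra.
Qed.

(** The direction is the normal [u] of the hyperplane or its opposite: if the height [s] were
    bounded on both sides, C would be bounded, since its projection is. *)
Lemma recession_direction (R : realType) n (C : set 'rV[R]_n) :
  cylindrically_bounded_body C ->
  exists2 v : 'rV[R]_n, v != 0 & forall x t, 0 <= t -> C x -> C (x + t *: v).
Proof.
move=> [clC unC cvC _ [u [c [u1 bpr]]] _].
have u0 : u != 0.
  apply: contra_eqN u1 => /eqP ->.
  rewrite /enorm /dot big1 ?sqrtr0; first by rewrite eq_sym oner_neq0.
  by move=> i _; rewrite mxE mul0r.
have /bounded_set_le[M prM] := bpr.
pose s x := dot x u - c.
have {}prM x : C x -> `|hyperplane_proj u c x| <= M by move=> Cx; apply: prM; exists x.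
have decE x : x = hyperplane_proj u c x + s x *: u.
  by rewrite /hyperplane_proj /s; apply/rowP => i; rewrite !mxE; ring.
have [unb|nunb] := pselect (forall K, exists2 x, C x & K < s x).
  exists u => //.
  exact: (@recession_unbounded _ _ C u (hyperplane_proj u c) s M).
exists (- u); first by rewrite oppr_eq0.
apply: (@recession_unbounded _ _ _ _ (hyperplane_proj u c) (fun x => - s x) M) => //.
  by move=> x; rewrite scalerN scaleNr opprK -decE.
move=> K; apply: contrapT => nK; apply: unC; apply/bounded_set_le.
have [K' nK'] : exists K', forall x, C x -> s x <= K'.
  apply: contrapT => /forallNP h; apply: nunb => K'.
  by have /existsNP[x /not_implyP[Cx /negP]] := h K'; rewrite -ltNge; exists x.
exists (M + Num.max K K' * `|u|) => x Cx.
rewrite [in leLHS](decE x) (le_trans (ler_normD _ _))// lerD ?prM//.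
rewrite normrZ ler_wpM2r// ler_norml le_max nK'// orbT andbT.
rewrite lerNl le_max; apply/orP; left; rewrite leNgt; apply/negP => Ks.
by apply: nK; exists x.
Qed.

(** If all x - k v lie in C, moving forward from them covers the whole line through x. This is where
    the absence of lines in C enters. *)
Lemma bigcap_recession_empty (R : realType) n (C : set 'rV[R]_n) (v : 'rV[R]_n) :
  cylindrically_bounded_body C -> v != 0 ->
  (forall x t, 0 <= t -> C x -> C (x + t *: v)) ->
  \bigcap_k [set x | C (x - k%:R *: v)] = set0.
Proof.
move=> hC v0 rec; apply/seteqP; split => // x Cx.
case: (cbb_no_line hC); exists x, v; split => // t.
pose k := (Num.truncn `|t|).+1.
have tk : - t <= k%:R.
  by rewrite (le_trans (ler_norm _))// normrN ltW// truncnS_gt.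
have := rec _ (t + k%:R) _ (Cx k I).
rewrite scalerDl addrA addrAC subrK; apply; lra.
Qed.

Lemma interior_cube (R : realType) n (C : set 'rV[R]_n) : C° !=set0 ->
  exists p : 'rV[R]_n, exists2 e : R, 0 < e &
    forall r, 0 < r -> r <= e -> cube p r `<=` C.
Proof.
move=> [p /nbhs_ballP[e /= e0 eC]]; exists p, e => // r r0 re x xQ.
apply: eC; rewrite -ball_normE /= distrC (lt_le_trans _ re)//.
by apply: norm_rV_lt => // i; rewrite !mxE; exact: xQ.
Qed.

(** * Translation and truncation *)

Section shift.
Context {R : realType} {n : nat}.
Implicit Types (C E : set 'rV[R]_n) (xi : 'rV[R]_n -> 'rV[R]_n).
Local Notation mu := (lebesgue_rV R n).

Lemma continuous_translation (a : 'rV[R]_n) :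
  continuous (fun y : 'rV[R]_n => y + a).
Proof. by move=> y; exact: (cvgD cvg_id (cvg_cst a)). Qed.

(** Translation by [a] maps the interior of C into itself, so the support of the moved field stays
    inside. *)
Lemma test_fields_shift C xi (a : 'rV[R]_n) : (forall x, C x -> C (x + a)) ->
  test_fields C xi -> test_fields C (fun x => xi (x - a)).
Proof.
move=> Ca [sxi cxi sub xi1].
have supE x : Defs.support (fun x => xi (x - a)) x -> Defs.support xi (x - a).
  move=> sx B /= nB.
  have /sx [y [/= xiy By]] : nbhs x ((fun y => y - a) @^-1` B).
    exact: (continuous_translation nB).
  by exists (y - a).
split.
- move=> i; apply/smooth_uptoP => k.
  have /smooth_uptoP sk := sxi i.
  exact: (smooth_upto_shift (f := component xi i)).
- apply: bounded_closed_compact; last exact: closed_closure.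
  have /compact_bounded /bounded_set_le[M HM] := cxi.
  apply/bounded_set_le; exists (M + `|a|) => x /supE /HM xM.
  by rewrite -[x](subrK a) (le_trans (ler_normD _ _))// lerD2r.
- move=> x /supE /sub xC.
  have : nbhs x ((fun y => y - a) @^-1` C) by exact: (continuous_translation xC).
  by apply: filterS => y /= /Ca; rewrite subrK.
- by move=> x; exact: xi1.
Qed.

Lemma divergence_shift xi (a : 'rV[R]_n) x :
  divergence (fun x => xi (x - a)) (x + a) = divergence xi x.
Proof.
apply: eq_bigr => i _; rewrite /partial.
rewrite (_ : component _ i = fun y => component xi i (y - a))//.
by rewrite derive_shift addrK.
Qed.

Lemma divergence_eq0 C xi x : test_fields C xi -> ~ C x -> divergence xi x = 0.
Proof.
move=> [_ _ sub _] nCx; apply: big1 => i _.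
have nsx : ~ Defs.support xi x by move=> /sub /interior_subset.
have : nbhs x (~` Defs.support xi).
  by apply: open_nbhs_nbhs; split => //; apply: closed_openC; exact: closed_closure.
move=> nx; rewrite /partial /derive; apply: cvg_lim => //; apply: cvg_near_cst.
have xi0 y : ~ Defs.support xi y -> component xi i y = 0.
  move=> nsy; rewrite /component; have [->|xy] := eqVneq (xi y) 0; first by rewrite mxE.
  by case: nsy; exact: subset_closure.
rewrite /= (xi0 x nsx).
have C0 : h *: (delta_mx 0 i : 'rV[R]_n) + x @[h --> (0 : R)] -->
    0 *: (delta_mx 0 i : 'rV[R]_n) + x.
  by apply: cvgD; [apply: cvgZr_tmp; exact: cvg_id|exact: cvg_cst].
rewrite scale0r add0r in C0.
have := nbhs_dnbhs (C0 _ nx).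
by apply: filterS => h /= /xi0 ->; rewrite subr0 scaler0.
Qed.

Lemma lebesgue_measurable_shift E (a : 'rV[R]_n) : lebesgue_measurable E ->
  lebesgue_measurable ((fun x => x + a) @^-1` E).
Proof.
move=> mE; rewrite -[X in lebesgue_measurable X]setTI.
exact: measurable_shift_cara.
Qed.

Lemma perimeter_shift C E (a : 'rV[R]_n) : lebesgue_measurable C ->
  lebesgue_measurable E ->
  (forall x, C x -> C (x + a)) ->
  (perimeter C ((fun x => x + a)%R @^-1` E `&` C) <= perimeter C E)%E.
Proof.
move=> mC mE Ca; apply: ge_ereal_sup => _ [xi txi <-].
have txi' := test_fields_shift Ca txi.
apply: le_trans (perimeter_ubound E txi').
have int : mu.-integrable setT (fun x => (divergence (fun x => xi (x - a)) x)%:E).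
  exact: test_fields_integrable txi'.
have inta : mu.-integrable setT
    (fun x => (divergence (fun x => xi (x - a)) (x + a))%:E).
  rewrite (_ : (fun x => _) = fun x => (divergence xi x)%:E).
    exact: test_fields_integrable txi.
  by apply/funext => x; rewrite divergence_shift.
have inta' : mu.-integrable ((fun x => x + a) @^-1` E)
    (fun x => (divergence (fun x => xi (x - a)) (x + a))%:E).
  apply: (integrableS measurableT _ _ inta); last by [].
  exact: lebesgue_measurable_shift.
have := @integral_shift_rV R n a E (fun x => (divergence (fun x => xi (x - a)) x)%:E)
  mE (measurable_int _ int) inta'.
(* Intersecting with C does not change the integral, as the divergence of [xi] vanishes off C. *)
move=> <-; rewrite integral_mkcondr.
rewrite le_eqVlt; apply/orP; left; apply/eqP; apply: eq_integral => x _.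
rewrite patchE divergence_shift; case: ifPn => // /negP xC.
by rewrite (divergence_eq0 txi)// => Cx; apply: xC; rewrite inE.
Qed.

End shift.

(** By additivity N c <= m B for every N, which forces c = 0 as m B is finite. *)
Lemma trivIset_same_measure_eq0 d (T : measurableType d) (R : realType)
    (m : {measure set T -> \bar R}) (F : (set T)^nat) (B : set T) (c : \bar R) :
  (forall k, measurable (F k)) -> trivIset setT F -> (forall k, m (F k) = c) ->
  measurable B -> (m B < +oo)%E -> (forall k, F k `<=` B) -> c = 0%E.
Proof.
move=> mF tF Fc mB Boo FB.
have c0 : (0 <= c)%E by rewrite -(Fc 0%N).
have sumle N : (\sum_(0 <= k < N) c <= m B)%E.
  apply: (@le_trans _ _ (\sum_(0 <= k < N) m (F k))%E).
    by apply: lee_sum => k _; rewrite Fc.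
  rewrite big_mkord -measure_bigsetU//.
  apply: le_measure; rewrite ?inE//; first exact: bigsetU_measurable.
  by move=> x; rewrite -bigcup_mkord => -[k _ /FB].
have mBf : m B \is a fin_num by rewrite ge0_fin_numE.
have cf : c \is a fin_num.
  rewrite ge0_fin_numE// (le_lt_trans _ Boo)//.
  by have := sumle 1%N; rewrite big_nat1.
apply/eqP; rewrite eq_le c0 andbT leNgt; apply/negP => cp.
have fc0 : 0 < fine c by rewrite fine_gt0// cp ltey_eq cf.
have := sumle (Num.truncn (fine (m B) / fine c)).+1.
rewrite -(fineK cf) -(fineK mBf) sumEFin lee_fin big_mkord sumr_const card_ord.
rewrite leNgt => /negP; apply.
by rewrite -mulr_natl -ltr_pdivrMr// truncnS_gt.
Qed.

(** * Volume of the truncations along a recession direction *)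

Section recession.
Context {R : realType} {n : nat}.
Variables (C : set 'rV[R]_n) (v : 'rV[R]_n).
Hypothesis clC : closed C.
Hypothesis rec : forall x t, 0 <= t -> C x -> C (x + t *: v).
Local Notation mu := (lebesgue_rV R n).

Definition shifted (t : R) : set 'rV[R]_n := [set x | C (x - t *: v)].

Lemma shifted_le s t : s <= t -> shifted t `<=` shifted s.
Proof.
move=> st x; rewrite /shifted /= => Cx.
have := rec (t := t - s) _ Cx; rewrite subr_ge0 => /(_ st).
by rewrite scalerBl addrA subrK.
Qed.

Lemma measurable_closed_rV : lebesgue_measurable C.
Proof.
apply: measurable_lebesgue; rewrite -[C]setCK; apply: measurableC.
by apply: open_rV_measurable; exact: closed_openC.
Qed.

Lemma measurable_shifted t : lebesgue_measurable (shifted t).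
Proof. exact: (lebesgue_measurable_shift (- (t *: v)) measurable_closed_rV). Qed.

Let h (k : nat) : R := k.+1%:R^-1.

Let h_gt0 k : 0 < h k. Proof. by rewrite invr_gt0. Qed.

Let h_small e : 0 < e -> exists k, h k <= e.
Proof.
move=> e0; exists (Num.truncn e^-1).
by rewrite /h -[leRHS]invrK lef_pV2 ?posrE ?invr_gt0// ltW// truncnS_gt.
Qed.

(** The points of C from which the backward ray along [v] leaves C at once. Its translate by T v is
    what [shifted T] has beyond the union of the [shifted t] with t > T. *)
Definition lower_boundary : set 'rV[R]_n := C `\` \bigcup_k shifted (h k).

Lemma measurable_lower_boundary : lebesgue_measurable lower_boundary.
Proof.
apply: measurableD; first exact: measurable_closed_rV.
by apply: bigcupT_measurable => k; exact: measurable_shifted.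
Qed.

(** A line parallel to [v] meets [lower_boundary] at most once: the point further back, moved
    forward by t - s - h k, shows that the other one can retreat by h k inside C. *)
Lemma lower_boundary_shift x s t : s < t ->
  lower_boundary (x - t *: v) -> lower_boundary (x - s *: v) -> False.
Proof.
move=> st [Cx _] [_]; apply.
have ts0 : 0 < t - s by rewrite subr_gt0.
have [k hk] := h_small ts0; exists k => //; rewrite /shifted /=.
have := rec (t := t - s - h k) _ Cx; rewrite subr_ge0 => /(_ hk).
have -> // : x - t *: v + (t - s - h k) *: v = x - s *: v - h k *: v.
by apply/rowP => i; rewrite !mxE; ring.
Qed.

(* The translates of [lower_boundary] along [v] are pairwise disjoint, and
   infinitely many translates of a bounded part of it fit in a cube. *)
Lemma lebesgue_lower_boundary : mu lower_boundary = 0%E.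
Proof.
pose D (M : nat) := lower_boundary `&` cube 0 M.+1%:R.
have mD M : lebesgue_measurable (D M).
  apply: measurableI; first exact: measurable_lower_boundary.
  by apply: measurable_lebesgue; exact: measurable_cube.
have D0 M : mu (D M) = 0%E.
  pose F (k : nat) := (fun x => x - h k *: v) @^-1` D M.
  (* Large enough for all translates, since [h k] is at most 1. *)
  pose B := cube (0 : 'rV[R]_n) (M.+1%:R + `|v|).
  have B0 : 0 < M.+1%:R + `|v| by rewrite ltr_wpDr.
  apply: (@trivIset_same_measure_eq0 _ _ _ mu F B).
  - by move=> k; exact: (lebesgue_measurable_shift (- (h k *: v)) (mD M)).
  - move=> i j _ _ [x [[/= Di _] [/= Dj _]]].
    have [ij|ji|//] := ltngtP i j.
      case: (lower_boundary_shift _ Di Dj).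
      by rewrite /h ltf_pV2 ?posrE// ltr_nat.
    case: (lower_boundary_shift _ Dj Di).
    by rewrite /h ltf_pV2 ?posrE// ltr_nat.
  - by move=> k; exact: (lebesgue_rV_shift (- (h k *: v)) (D M)).
  - by apply: measurable_lebesgue; exact: measurable_cube.
  - suff : (lebesgue_rV R n B < +oo)%E by [].
    by rewrite lebesgue_rV_cube// ltry.
  - move=> k x [/= _ xM] i; have := xM i; rewrite !mxE !subr0 => xi.
    rewrite -[x 0 i](subrK (h k * v 0 i)) (le_lt_trans (ler_normD _ _))//.
    rewrite ltr_leD// normrM ger0_norm ?(ltW (h_gt0 k))//.
    rewrite (le_trans _ (ler_coord_norm v i))// ler_piMl//.
    by rewrite /h invf_le1// ler1n.
have DE : lower_boundary = \bigcup_M D M.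
  apply/seteqP; split => x; last by move=> [M _ []].
  move=> lx; exists (Num.truncn `|x|) => //; split => //.
  by apply: norm_lt_cube; exact: truncnS_gt.
have mDU : lebesgue_measurable (\bigcup_M D M).
  by rewrite -DE; exact: measurable_lower_boundary.
apply/eqP; rewrite eq_le measure_ge0 andbT DE.
apply: le_trans (generalized_Boole_inequality mu mD mDU) _.
by rewrite eseries0// => i _ _; exact: D0.
Qed.

Section truncation.
Variable E : set 'rV[R]_n.
Hypothesis mE : lebesgue_measurable E.
Hypothesis EC : E `<=` C.
Hypothesis Eoo : (mu E < +oo)%E.

Let S t := E `&` shifted t.

Let mS t : lebesgue_measurable (S t).
Proof. by apply: measurableI; [exact: mE|exact: measurable_shifted]. Qed.

Let S_le s t : s <= t -> S t `<=` S s.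
Proof. by move=> st x [Ex /(shifted_le st)]. Qed.

Let muS_le s t : s <= t -> (mu (S t) <= mu (S s))%E.
Proof.
move=> st; apply: le_measure; rewrite ?inE; [exact: mS|exact: mS|exact: S_le].
Qed.

Let muS_lt t : (mu (S t) < +oo)%E.
Proof.
apply: le_lt_trans Eoo; apply: le_measure; rewrite ?inE; [exact: mS|exact: mE|].
exact: subIsetl.
Qed.

Let S0 t : t <= 0 -> S t = E.
Proof.
move=> t0; apply/seteqP; split => [x []//|x Ex]; split => //.
have := rec (t := - t) _ (EC Ex); rewrite oppr_ge0 => /(_ t0).
by rewrite /shifted /= scaleNr.
Qed.

Lemma truncation_cvg0 : \bigcap_k shifted k%:R = set0 ->
  mu (E `&` shifted k%:R) @[k --> \oo] --> 0%E.
Proof.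
move=> cap0.
have capS : \bigcap_k S k%:R = set0.
  rewrite -subset0 -cap0 => x Sx k _; by have [] := Sx k I.
rewrite -[X in _ --> X](measure0 mu) -capS.
apply: (@nonincreasing_cvg_mu _ _ _ mu (fun k : nat => S k%:R)).
- exact: muS_lt.
- by move=> k; exact: mS.
- by rewrite capS; exact: measurable0.
- by move=> i j ij; rewrite subsetEset; apply: S_le; rewrite ler_nat.
Qed.

(** An intermediate value argument at the supremum T of the t whose truncation still has volume at
    least w; the two inequalities are the one-sided continuities at T. *)
Lemma truncation_measure (w : R) : \bigcap_k shifted k%:R = set0 ->
  0 < w -> (w%:E <= mu E)%E -> exists t, mu (E `&` shifted t) = w%:E.
Proof.
move=> cap0 w0 wE.
pose A := [set t : R | (w%:E <= mu (S t))%E].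
have A0 : A 0 by rewrite /A /= S0.
have [N SN] : exists N : nat, (mu (S N%:R) < w%:E)%E.
  have := truncation_cvg0 cap0 => /(_ [set y | (y < w%:E)%E]).
  have nb : nbhs (0 : \bar R)%E [set y | (y < w%:E)%E].
    by apply: open_nbhs_nbhs; split; [exact: open_ereal_lt_ereal|rewrite /= lte_fin].
  by move=> /(_ nb) [N _ /(_ N (leqnn N))]; exists N.
have ubA t : A t -> t <= N%:R.
  move=> At; rewrite leNgt; apply/negP => /ltW /muS_le Nt.
  by have := le_lt_trans (le_trans At Nt) SN; rewrite ltxx.
have supA : has_sup A by split; [exists 0|exists N%:R].
pose T := sup A; exists T; apply/eqP; rewrite eq_le; apply/andP; split.
(* From the right: [S T] exceeds the union of the later truncations by a subset of a translate of
   the null set [lower_boundary]. *)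
- have T_lt k : (mu (S (T + h k)) <= w%:E)%E.
    rewrite leNgt; apply/negP => /ltW Ak.
    have := @ub_le_sup _ _ supA.2 _ Ak; rewrite -/T gerDl.
    by rewrite leNgt h_gt0.
  have mU : lebesgue_measurable (\bigcup_k S (T + h k)).
    by apply: bigcupT_measurable => k; exact: mS.
  have cvU : mu (S (T + h k)) @[k --> \oo] --> mu (\bigcup_k S (T + h k)).
    apply: (@nondecreasing_cvg_mu _ _ _ mu (fun k : nat => S (T + h k))).
    + by move=> k; exact: mS.
    + exact: mU.
    + move=> i j ij; rewrite subsetEset; apply: S_le; rewrite lerD2l.
      by rewrite /h lef_pV2 ?posrE// ler_nat.
  have Uw : (mu (\bigcup_k S (T + h k)) <= w%:E)%E.
    by apply: (cvge_to_le cvU); apply: nearW => k; exact: T_lt.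
  pose L := (fun x => x - T *: v) @^-1` lower_boundary.
  have mL : lebesgue_measurable L.
    exact: (lebesgue_measurable_shift (- (T *: v)) measurable_lower_boundary).
  have L0 : mu L = 0%E.
    exact: (etrans (lebesgue_rV_shift (- (T *: v)) lower_boundary)
      lebesgue_lower_boundary).
  apply: (@le_trans _ _ (mu (\bigcup_k S (T + h k) `|` L))).
    apply: le_measure; rewrite ?inE; [exact: mS|exact: measurableU|].
    move=> x [Ex Sx].
    have [[k _ xk]|nU] := pselect ((\bigcup_k shifted (T + h k)) x).
      by left; exists k.
    right; split => // -[k _ xk]; apply: nU; exists k => //; move: xk.
    by rewrite /shifted /= scalerDl opprD addrA.
  apply: le_trans (measureU2 mu mU mL) _.
  rewrite -[leRHS]adde0; apply: leeD; first exact: Uw.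
  by rewrite le_eqVlt; apply/orP; left; apply/eqP; exact: L0.
(* From the left: C is closed, so the truncations decrease to [S T] itself. *)
- have capS : \bigcap_k S (T - h k) = S T.
    apply/seteqP; split => x; last first.
      by move=> Sx k _; apply: S_le Sx; rewrite gerBl ltW.
    move=> Sx; split; first by have [] := Sx 0%N I.
    rewrite /shifted /=; apply: closed_approx => // e e0.
    have [k hk] : exists k, h k <= e / (`|v| + 1).
      by apply: h_small; rewrite divr_gt0// ltr_wpDl.
    have [_ Sk] := Sx k I; exists (x - (T - h k) *: v) => //.
    have -> : x - T *: v - (x - (T - h k) *: v) = - (h k *: v).
      by apply/rowP => i; rewrite !mxE; ring.
    rewrite normrN normrZ ger0_norm ?(ltW (h_gt0 k))//.
    move: hk; rewrite ler_pdivlMr ?ltr_wpDl// => /(lt_le_trans _); apply.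
    by rewrite ltr_pM2l// ltrDl.
  have cvS : mu (S (T - h k)) @[k --> \oo] --> mu (S T).
    rewrite -capS.
    apply: (@nonincreasing_cvg_mu _ _ _ mu (fun k : nat => S (T - h k))).
    + exact: muS_lt.
    + by move=> k; exact: mS.
    + by rewrite capS; exact: mS.
    + move=> i j ij; rewrite subsetEset; apply: S_le; rewrite lerD2l lerN2.
      by rewrite /h lef_pV2 ?posrE// ler_nat.
  apply: (cvge_to_ge cvS); apply: nearW => k.
  have [t At Tt] := sup_adherent (h_gt0 k) supA.
  by apply: le_trans At _; apply: muS_le; exact: ltW.
Qed.

End truncation.

End recession.

(** * The isoperimetric profile *)

Section profile.
Context {R : realType} {n : nat}.
Implicit Types (C E : set 'rV[R]_n) (v w : R).
Local Notation mu := (lebesgue_rV R n).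

Lemma test_fields_cst0 C : test_fields C (fun=> 0).
Proof.
have sup0 : Defs.support (fun=> 0 : 'rV[R]_n) = set0.
  rewrite /Defs.support (_ : [set _ | _] = set0) ?closure0//.
  by apply/seteqP; split => // x /=; rewrite eqxx.
split; rewrite ?sup0//.
- move=> i; rewrite (_ : component _ i = fun=> 0).
    by apply/smooth_uptoP => k; exact: smooth_upto_cst.
  by apply/funext => x; rewrite /component mxE.
- exact: compact0.
- move=> x; rewrite /enorm /dot big1 ?sqrtr0// => i _.
  by rewrite mxE mul0r.
Qed.

Lemma perimeter_ge0 C E : (0 <= perimeter C E)%E.
Proof.
apply: le_trans (perimeter_ubound E (test_fields_cst0 C)).
rewrite integral0_eq// => x _; rewrite /divergence big1// => i _.
rewrite (_ : component _ i = cst 0); first by rewrite /partial derive_cst.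
by apply/funext => y; rewrite /component mxE.
Qed.

Lemma perimeter_set0 C : perimeter C set0 = 0%E.
Proof.
apply/eqP; rewrite eq_le perimeter_ge0 andbT.
by apply: ge_ereal_sup => _ [xi _ <-]; rewrite integral_set0.
Qed.

Lemma isoperimetric_profile_le C E v : lebesgue_measurable E -> E `<=` C ->
  mu E = v%:E -> (isoperimetric_profile C v <= perimeter C E)%E.
Proof.
move=> mE EC Ev; rewrite /isoperimetric_profile; case: ifP => _.
  exact: perimeter_ge0.
by apply: ereal_inf_lbound; exists E.
Qed.

(** At v = 0 the value 0 set by convention is the perimeter of the empty set, so that case obeys the
    same rule. *)
Lemma isoperimetric_profile_glb C v (M : \bar R) :
  (forall E, lebesgue_measurable E -> E `<=` C -> mu E = v%:E ->
    (M <= perimeter C E)%E) ->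
  (M <= isoperimetric_profile C v)%E.
Proof.
move=> MP; rewrite /isoperimetric_profile; case: ifP => [/eqP v0|_].
  rewrite -(perimeter_set0 C); apply: MP => //.
    exact: measurable0.
  by rewrite v0 measure0.
by apply: le_ereal_inf_tmp => _ [E [mE EC Ev] <-]; exact: MP.
Qed.

Lemma isoperimetric_profile_ge0 C v : (0 <= isoperimetric_profile C v)%E.
Proof. by apply: isoperimetric_profile_glb => E _ _ _; exact: perimeter_ge0. Qed.

Section recession_profile.
Variables (C : set 'rV[R]_n) (d : 'rV[R]_n).
Hypothesis clC : closed C.
Hypothesis rec : forall x t, 0 <= t -> C x -> C (x + t *: d).
Hypothesis capC : \bigcap_k shifted C d k%:R = set0.

Lemma isoperimetric_profile_nondecreasing v w : 0 <= v -> v <= w ->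
  (isoperimetric_profile C v <= isoperimetric_profile C w)%E.
Proof.
move=> v0 vw; apply: isoperimetric_profile_glb => E mE EC Ew.
have [->|vN0] := eqVneq v 0.
  by rewrite /isoperimetric_profile eqxx perimeter_ge0.
have vgt0 : 0 < v by rewrite lt_neqAle eq_sym vN0.
have Eoo : (mu E < +oo)%E by apply: (@le_lt_trans _ _ w%:E); [rewrite -Ew|exact: ltry].
have vE : (v%:E <= mu E)%E by apply: (@le_trans _ _ w%:E); [rewrite lee_fin|rewrite -Ew].
have [t Et] := truncation_measure clC rec mE EC Eoo capC vgt0 vE.
(* Only forward translations preserve C. For negative t the truncation is all of E, and t = 0 does
   as well. *)
wlog t0 : t Et / 0 <= t.
  move=> wl; have [|t0] := leP 0 t; first exact: wl.
  apply: (wl 0) => //; rewrite -Et; congr mu.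
  apply/seteqP; split => x [Ex _]; split => //; rewrite /shifted /=.
    by rewrite -scaleNr; apply: rec; [rewrite oppr_ge0 ltW|exact: EC].
  by rewrite scale0r subr0; exact: EC.
pose F := (fun x => x + t *: d) @^-1` E `&` C.
have FE : F = (fun x => x + t *: d) @^-1` (E `&` shifted C d t).
  by apply/seteqP; split => x [Ex Cx]; split => //; move: Cx; rewrite /shifted /= addrK.
apply: (@le_trans _ _ (perimeter C F)).
  apply: isoperimetric_profile_le.
  - rewrite FE; apply: lebesgue_measurable_shift.
    by apply: measurableI; [exact: mE|exact: measurable_shifted].
  - exact: subIsetr.
  - by rewrite FE -Et; exact: lebesgue_rV_shift.
apply: perimeter_shift => //; first exact: measurable_closed_rV.
by move=> x; exact: rec.
Qed.

(** The exact gain in volume depends on E but is at least half the cube; monotonicity lowers it to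
    that half, which depends only on r. *)
Lemma isoperimetric_profile_cube (p : 'rV[R]_n) (r v : R) : 0 < r ->
  cube p r `<=` C -> 0 <= v ->
  (isoperimetric_profile C (v + (r *+ 2) ^+ n / 2) <=
   isoperimetric_profile C v + (n%:R * (pi * (2 * pi * r) ^+ n.-1))%:E)%E.
Proof.
move=> r0 QC v0; set c := n%:R * _.
(* With the cost on the left, the claim is a lower bound of an infimum and can be tested on each
   competitor E. *)
rewrite -leeBlDr//; apply: isoperimetric_profile_glb => E mE EC Ev; rewrite leeBlDr//.
pose q : R := (r *+ 2) ^+ n.
have q0 : 0 < q by rewrite exprn_gt0// pmulrn_lgt0.
have Eoo : (mu E < +oo)%E by apply: (@le_lt_trans _ _ v%:E); [rewrite -Ev|exact: ltry].
have [k Ek] : exists k : nat, (mu (E `&` shifted C d k%:R) < (q / 2)%:E)%E.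
  have := truncation_cvg0 clC rec mE Eoo capC => /(_ [set y | (y < (q / 2)%:E)%E]).
  have nb : nbhs (0 : \bar R)%E [set y | (y < (q / 2)%:E)%E].
    apply: open_nbhs_nbhs; split; first exact: open_ereal_lt_ereal.
    by rewrite /= lte_fin divr_gt0.
  by move=> /(_ nb) [N _ /(_ N (leqnn N))]; exists N.
(* The moved cube lies in [shifted C d k%:R], where E has less than half the volume of the cube. *)
pose p' := p + k%:R *: d; pose Q := cube p' r.
have mQ : lebesgue_measurable Q by apply: measurable_lebesgue; exact: measurable_cube.
have QS : Q `<=` shifted C d k%:R.
  move=> x xQ; apply: QC => i; have := xQ i; rewrite /p' !mxE.
  by congr (`|_| < _); ring.
have QC' : Q `<=` C.
  by move=> x /QS Cx; rewrite -[x](subrK (k%:R *: d)); apply: rec.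
have muQ : mu Q = q%:E by exact: lebesgue_rV_cube.
have mQE : lebesgue_measurable (Q `\` E) by exact: measurableD.
have mQI : lebesgue_measurable (Q `&` E) by exact: measurableI.
have QI : (mu (Q `&` E) <= (q / 2)%:E)%E.
  apply: le_trans (ltW Ek); apply: le_measure; rewrite ?inE.
  - exact: mQI.
  - by apply: measurableI; [exact: mE|exact: measurable_shifted].
  - by move=> x [/QS Sx Ex].
have Qsum : (mu (Q `\` E) + mu (Q `&` E) = q%:E)%E.
  by rewrite -muQ [RHS](measureDI mu mQ mE).
have Usum : (mu (E `|` Q) = mu E + mu (Q `\` E))%E.
  rewrite -[LHS](_ : mu (E `|` (Q `\` E)) = _); last first.
    by congr mu; rewrite setDE setUIr setUv setIT.
  by apply: measureU => //; rewrite setDE setICA setICr setI0.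
have QEf : mu (Q `\` E) \is a fin_num.
  rewrite ge0_fin_numE ?measure_ge0//; apply: (@le_lt_trans _ _ q%:E); last exact: ltry.
  by rewrite -Qsum leeDl ?measure_ge0.
have QIf : mu (Q `&` E) \is a fin_num.
  rewrite ge0_fin_numE ?measure_ge0//; exact: le_lt_trans QI (ltry _).
set a := fine (mu (Q `\` E)); set b := fine (mu (Q `&` E)).
have ab : a + b = q by apply: EFin_inj; rewrite EFinD !fineK.
have bq : b <= q / 2 by rewrite -lee_fin fineK.
apply: (@le_trans _ _ (isoperimetric_profile C (v + a))).
  apply: isoperimetric_profile_nondecreasing.
    by rewrite addr_ge0// divr_ge0// ltW.
  rewrite lerD2l -/q; lra.
apply: (@le_trans _ _ (perimeter C (E `|` Q))).
  apply: isoperimetric_profile_le.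
  - by apply: measurableU; [exact: mE|exact: mQ].
  - by move=> x [/EC|/QC'].
  - by rewrite Usum Ev EFinD fineK.
exact: perimeter_setU_cube.
Qed.

End recession_profile.
End profile.

(** Taking r at most 1 / (2 pi) gives (2 pi r) ^ n <= 2 pi r, by n >= 1, and the cost becomes linear
    in r, at most K r. *)
Lemma small_cube_cost (R : realType) (n : nat) (e eps : R) : (1 <= n)%N ->
  0 < e -> 0 < eps ->
  exists r, [/\ 0 < r, r <= e & n.+1%:R * (pi * (2 * pi * r) ^+ n) <= eps].
Proof.
case: n => // n _ e0 eps0; have pi0 := pi_gt0 R.
pose K : R := n.+2%:R * (pi * (2 * pi)).
have K0 : 0 < K by rewrite !mulr_gt0.
exists (Num.min e (Num.min (2 * pi)^-1 (eps / K))).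
set r := Num.min e _.
have r0 : 0 < r by rewrite !lt_min e0 invr_gt0 mulr_gt0// divr_gt0.
split => //; first by rewrite ge_min lexx.
have r1 : 2 * pi * r <= 1.
  by rewrite mulrC -ler_pdivlMr ?mulr_gt0// mul1r !ge_min lexx /= orbT.
have rK : r * K <= eps by rewrite -ler_pdivlMr// !ge_min lexx !orbT.
have p0 : 0 <= 2 * pi * r by rewrite !mulr_ge0// ltW.
apply: le_trans rK; rewrite (_ : r * K = n.+2%:R * (pi * (2 * pi * r))).
  by rewrite !ler_pM2l// exprS ler_piMr// exprn_ile1.
by rewrite /K; ring.
Qed.

Theorem proposition4p4 (R : realType) (n : nat) (hn : (1 <= n)%N)
    (C : set 'rV[R]_n.+1) (hC : cylindrically_bounded_body C) :
  (forall v : R, 0 <= v -> isoperimetric_profile C v \is a fin_num) /\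
  {within `[0, +oo[, continuous (fun v : R => fine (isoperimetric_profile C v))}.
Proof.
have clC := cbb_closed hC.
have [d d0 rec] := recession_direction hC.
have capC : \bigcap_k shifted C d k%:R = set0 := bigcap_recession_empty hC d0 rec.
have [p [e e0 QC]] := interior_cube (cbb_interior hC).
set I := isoperimetric_profile C.
have nd v w : 0 <= v -> v <= w -> (I v <= I w)%E.
  exact: (isoperimetric_profile_nondecreasing clC rec capC).
have incr eps : 0 < eps -> exists2 dlt, 0 < dlt &
    forall v, 0 <= v -> (I (v + dlt)%R <= I v + eps%:E)%E.
  move=> eps0; have [r [r0 re rcost]] := small_cube_cost hn e0 eps0.
  exists ((r *+ 2) ^+ n.+1 / 2); first by rewrite divr_gt0// exprn_gt0// pmulrn_lgt0.
  move=> v v0.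
  apply: le_trans (isoperimetric_profile_cube clC rec capC r0 (QC r r0 re) v0) _.
  by rewrite leeD2l// lee_fin.
have Ifin v : 0 <= v -> I v \is a fin_num.
  move=> v0; rewrite ge0_fin_numE ?isoperimetric_profile_ge0//.
  have [dlt dlt0 Idlt] := incr 1 ltr01.
  (* Starting from the value 0 at volume 0, each step of length [dlt] adds at most 1. *)
  have Ik k : (I (k%:R * dlt)%R <= k%:R%:E)%E.
    elim: k => [|k IHk]; first by rewrite mul0r /I /isoperimetric_profile eqxx.
    rewrite -natr1 mulrDl mul1r (le_trans (Idlt _ _))//.
      by rewrite mulr_ge0// ltW.
    by rewrite EFinD leeD2r.
  apply: (@le_lt_trans _ _ (I ((Num.truncn (v / dlt)).+1%:R * dlt)%R)).
    by apply: nd => //; rewrite -ler_pdivrMr// ltW// truncnS_gt.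
  by rewrite (le_lt_trans (Ik _))// ltry.
split=> //; apply/subspace_continuousP => x /=; rewrite in_itv /= andbT => x0.
apply/cvgrPdist_lt => eps eps0; rewrite near_withinE.
have eps20 : 0 < eps / 2 by rewrite divr_gt0.
have [dlt dlt0 Idlt] := incr _ eps20.
(* The same [dlt] serves every v, so continuity is uniform; halving [eps] yields the strict
   inequality. *)
have mod_le v w : 0 <= v -> v <= w -> w - v < dlt ->
    `|fine (I v) - fine (I w)| < eps.
  move=> v0 vw wv; have w0 := le_trans v0 vw.
  have h1 : fine (I v) <= fine (I w) by rewrite fine_le ?Ifin ?nd.
  have h2 : fine (I w) <= fine (I v) + eps / 2.
    rewrite -lee_fin EFinD !fineK ?Ifin//; apply: le_trans (Idlt v v0).
    by apply: nd => //; lra.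
  by rewrite ltr_norml; apply/andP; split; lra.
apply/nbhs_ballP; exists dlt => //= y xy; rewrite in_itv /= andbT => y0.
move: xy; rewrite -ball_normE /= ltr_norml => /andP[xy1 xy2].
have [xy|/ltW yx] := leP x y; first by apply: mod_le => //; lra.
by rewrite distrC; apply: mod_le => //; lra.
Qed.
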